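(* Define $$u:=u_f+u_\delta,\qquad u_f:=\sum_{j=0}^{N_0}\tilde u_j,\qquad u_\delta:=\sum_{j=1}^{N_0-1}\mu_j\tilde v_j,$$ where $\{\mu_j\}_{j=1}^{N_0-1}$ is the unique solution to the linear system induced by the identity of distributions $$\sum_{j=1}^{N_0-1}\mu_j\,\tilde\delta_{x_j}=-\sum_{j=1}^{N_0-1}\bigl(d_{x_j}(\tilde u_{j-1})+d_{x_j}(\tilde u_{j+1})\bigr)\,\delta_{x_j}.$$ Then $u$ must be the weak solution to the heterogeneous Helmholtz equation $$\mathcal{L}u=[a u']'+\kappa^2u=f\ \text{ on }(0,1)\qquad\text{with}\qquad \mathcal{B}_0u(0)=g_0,\quad \mathcal{B}_1u(1)=g_1.$$
   Context: Setting. All functions are complex-valued unless stated otherwise. Let $a,\kappa\in L_\infty(0,1)$ with $a$ real-valued and $\operatorname{ess\,inf}_{x\in(0,1)}a(x)>0$, let $f\in L_2(0,1)$, $g_0,g_1\in\mathbb{C}$, and let $\mathcal{L}u:=[a u']'+\kappa^2u$ in the sense of distributions. Boundary operators: $$\mathcal{B}_0u(0):=\lambda_0^Lu(0)+\lambda_1^Lu'(0),\qquad \mathcal{B}_1u(1):=\lambda_0^Ru(1)+\lambda_1^Ru'(1),$$ where $\lambda_0^L,\lambda_1^L,\lambda_0^R,\lambda_1^R\in\mathbb{C}$, $|\lambda_0^L|+|\lambda_1^L|\neq0$, $|\lambda_0^R|+|\lambda_1^R|\neq0$. Here $u'(0)$ and $u'(1)$ are one-sided limits; if $\lambda_1^L\ne0$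 (resp. $\lambda_1^R\neq 0$) it is assumed that the one-sided limit $a(0+)$ (resp. $a(1-)$) exists, so that $u'(0)=\lim_{x\to0^+}(au')(x)/a(0+)$ (resp. $u'(1)=\lim_{x\to1^-}(au')(x)/a(1-)$). A weak solution on an interval is an $H^1$ function satisfying the equation in the sense of distributions on the open interval together with the boundary conditions. Partition. Let $N_0\ge2$ be an integer, $0=x_0<x_1<\dots<x_{N_0}=1$, $x_{-1}:=0$, $x_{N_0+1}:=1$. For $0\le j\le N_0$ let $\varphi_j$ be the continuous piecewise linear hat function on $[0,1]$ with respect to this partition with $\varphi_j(x_j)=1$ and $\varphi_j(x_k)=0$ for $k\ne j$, so it is supported on $[x_{j-1},x_{j+1}]$ and $\sum_{j=0}^{N_0}\varphi_j=1$. Put $f_j:=f\varphi_j$. Regular local problems. For $0\le j\le N_0$, $u_j\in H^1(x_{j-1},x_{j+1})$ is the weak solution to $\mathcal{L}u_j=f_j$ on $(x_{j-1},x_{j+1})$ with homogeneous Dirichlet conditions $u_j(x_{j-1})=0$ if $x_{j-1}\ne0$ and $u_j(x_{j+1})=0$ if $x_{j+1}\neq1$, and at the endpoints $0$ and $1$: $\mathcal{B}_0u_0(0)=g_0$, $\mathcal{B}_0u_1(0)=0$, $\mathcal{B}_1u_{N_0}(1)=g_1$, $\mathcal{B}_1u_{N_0-1}(1)=0$. $\tilde u_j\in H^1(0,1)$ is the extension of $u_j$ by zero outside $[x_{j-1},x_{j+1}]$. Dirac local problems. For $j=1,\dots,N_0-1$, $v_j\in H^1(x_{j-1},x_{j+1})$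 is the weak solution to $\mathcal{L}v_j=\delta_{x_j}$ on $(x_{j-1},x_{j+1})$, where $\delta_{x_j}$ is the Dirac distribution at $x_j$, with $v_j(x_{j-1})=0$ if $x_{j-1}\neq0$, $\mathcal{B}_0v_j(0)=0$ if $x_{j-1}=0$, $v_j(x_{j+1})=0$ if $x_{j+1}\ne1$, and $\mathcal{B}_1v_j(1)=0$ if $x_{j+1}=1$. $\tilde v_j\in H^1(0,1)$ is the extension of $v_j$ by zero outside $[x_{j-1},x_{j+1}]$. Fluxes. For $w=\tilde u_j$ or $w=\tilde v_j$ define $$d_{x_{j-1}}(w):=\lim_{x\to x_{j-1}^+}a(x)w'(x)\ \ (x_{j-1}\ne0),\qquad d_{x_{j+1}}(w):=-\lim_{x\to x_{j+1}^-}a(x)w'(x)\ \ (x_{j+1}\ne1).$$ As a distribution on $(0,1)$, $$\tilde\delta_{x_j}:=\mathcal{L}\tilde v_j=\delta_{x_j}+d_{x_{j-1}}(\tilde v_j)\,\delta_{x_{j-1}}+d_{x_{j+1}}(\tilde v_j)\,\delta_{x_{j+1}},$$ where the second term is omitted if $x_{j-1}=0$ and the third is omitted if $x_{j+1}=1$. Standing assumption (unique solvability). On each of the intervals $(0,1)$, $(x_{j-1},x_{j+1})$ for $1\le j\le N_0-1$, and $(x_j,x_{j+1})$ for $0\le j\le N_0-1$, the homogeneous equation $\mathcal{L}w=0$ has only the zero weak solution in $H^1$ under the homogeneous boundary conditions: $w=0$ at an endpoint in the open interval $(0,1)$; $\mathcal{B}_0w(0)=0$ at the endpoint $0$; $\mathcal{B}_1w(1)=0$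 at the endpoint $1$. In particular all the boundary value problems mentioned have unique weak solutions. *)

(* Defs.v *)
From HB Require Import structures.
From mathcomp Require Import all_boot all_order all_algebra.
From mathcomp Require Import all_classical all_reals all_analysis ess_sup_inf.
From mathcomp Require Import complex.
Import Order.TTheory GRing.Theory Num.Theory.
Import numFieldNormedType.Exports.

Set Implicit Arguments.
Unset Strict Implicit.
Unset Printing Implicit Defensive.

Local Open Scope classical_set_scope.
Local Open Scope ring_scope.
Local Open Scope complex_scope.

(* The topology of the modulus on R[i]; the library only declares it on the
   alias R[i]^o. *)
#[export, non_forgetful_inheritance]
HB.instance Definition _ (R : realType) := NormedModule.copy R[i] R[i]^o.

Section FunctionSpaces.
Context {R : realType}.
Local Notation mu := (@lebesgue_measure R).
Implicit Types (c d x : R) (u w : R -> R[i]) (phi : R -> R).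

Definition cintegral (D : set R) w : R[i] :=
  (\int[mu]_(x in D) complex.Re (w x))%R +i* (\int[mu]_(x in D) complex.Im (w x))%R.

Definition Lp (p : \bar R) c d w : Prop :=
  [/\ measurable_fun `]c, d[ (fun x => complex.Re (w x)),
      measurable_fun `]c, d[ (fun x => complex.Im (w x)) &
      (Lnorm mu p (fun x => (ComplexField.Normc.normc (patch (cst 0) `]c, d[ w x))%:E) < +oo)%E].

Definition ess_inf_on c d (a : R -> R) : \bar R :=
  ess_inf mu (patch (cst +oo%E) `]c, d[ (EFin \o a)).

(* Real-valued test functions suffice: a distribution is complex-valued and
   extends to complex test functions by linearity. *)
Definition test_function c d phi : Prop :=
  (forall n x, derivable (derive1n n phi) x 1) /\
  exists p q : R, [/\ c < p, q < d & forall x, x \notin `[p, q] -> phi x = 0].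

Definition distribution := (R -> R) -> R[i].

Definition distr_eq c d (S T : distribution) : Prop :=
  forall phi, test_function c d phi -> S phi = T phi.

Definition dirac_distr x : distribution := fun phi => (phi x)%:C.

Definition regular_distr c d w : distribution :=
  fun phi => cintegral `]c, d[ (fun x => w x * (phi x)%:C).

Definition deriv_distr (T : distribution) : distribution :=
  fun phi => - T (derive1 phi).

Definition is_wderiv c d u w : Prop :=
  Lp 2%:E c d w /\
  distr_eq c d (deriv_distr (regular_distr c d u)) (regular_distr c d w).

Definition H1 c d u : Prop :=
  [/\ {within `[c, d], continuous u}, Lp 2%:E c d u & exists w, is_wderiv c d u w].

Definition wderiv c d u : R -> R[i] := xget (cst 0) [set w | is_wderiv c d u w].

(* One-sided limits of elements of L_infty and L_2 are taken modulo null sets: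
   these are the filters of right (resp. left) neighbourhoods of x up to
   Lebesgue-negligible sets. *)
Definition ess_at_right x : set_system R :=
  [set A | \forall r \near 0^'+, {ae mu, forall y, x < y < x + r -> A y}].

Definition ess_at_left x : set_system R :=
  [set A | \forall r \near 0^'+, {ae mu, forall y, x - r < y < x -> A y}].

End FunctionSpaces.

Record helmholtz (R : realType) := Helmholtz {
  coef_a : R -> R;
  coef_kappa : R -> R[i];
  lam0L : R[i];
  lam1L : R[i];
  lam0R : R[i];
  lam1R : R[i] }.

Section Helmholtz.
Context {R : realType} (P : helmholtz R).
Implicit Types (c d x y t : R) (u w : R -> R[i]).

Definition aC t : R[i] := (coef_a P t)%:C.

Definition Lop c d u : distribution := fun phi =>
  deriv_distr (regular_distr c d (fun t => aC t * wderiv c d u t)) phi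
  + regular_distr c d (fun t => coef_kappa P t ^+ 2 * u t) phi.

(* a u' for u in H^1(c, d) *)
Definition flux c d u t : R[i] := aC t * wderiv c d u t.

Definition B0 c d u : R[i] :=
  lam0L P * u 0
  + lam1L P * (lim (flux c d u @ ess_at_right 0) / lim (aC @ ess_at_right 0)).

Definition B1 c d u : R[i] :=
  lam0R P * u 1
  + lam1R P * (lim (flux c d u @ ess_at_left 1) / lim (aC @ ess_at_left 1)).

(* [lim] is total, hence the explicit existence of the limit defining u'(0). *)
Definition left_bc c d g u : Prop :=
  if c == 0 then (lam1L P != 0 -> cvg (flux c d u @ ess_at_right 0)) /\
                 B0 c d u = g
  else u c = 0.

Definition right_bc c d g u : Prop :=
  if d == 1 then (lam1R P != 0 -> cvg (flux c d u @ ess_at_left 1)) /\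
                 B1 c d u = g
  else u d = 0.

(* u is represented by its continuous representative on [c, d]. The data gl
   (resp. gr) are only used when c = 0 (resp. d = 1); the condition at an
   interior endpoint is homogeneous Dirichlet. *)
Definition weak_solution c d (T : distribution) (gl gr : R[i]) u : Prop :=
  [/\ H1 c d u, distr_eq c d (Lop c d u) T,
      left_bc c d gl u & right_bc c d gr u].

Definition uniquely_solvable c d : Prop :=
  forall w, weak_solution c d (fun=> 0) 0 0 w -> {in `[c, d], forall t, w t = 0}.

End Helmholtz.

Section Decomposition.
Context {R : realType} (P : helmholtz R) (N : nat) (x : nat -> R).

(* x_{j-1} and x_{j+1}, with x_{-1} = x_0 and x_{N+1} = x_N *)
Definition xprev j := x j.-1.
Definition xnext j := x (minn j.+1 N).

Definition hat j t : R :=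
  if t == x j then 1
  else if xprev j < t < x j then (t - xprev j) / (x j - xprev j)
  else if x j < t < xnext j then (xnext j - t) / (xnext j - x j)
  else 0.

Definition zero_ext j (w : R -> R[i]) : R -> R[i] :=
  patch (cst 0) `[xprev j, xnext j] w.

(* d_y(w) when y is the left (resp. right) endpoint of the support of w *)
Definition flux_left_end (y : R) (w : R -> R[i]) : R[i] :=
  lim (flux P 0 1 w @ ess_at_right y).
Definition flux_right_end (y : R) (w : R -> R[i]) : R[i] :=
  - lim (flux P 0 1 w @ ess_at_left y).

Definition left_data (g0 : R[i]) j : R[i] := if j == 0%N then g0 else 0.
Definition right_data (g1 : R[i]) j : R[i] := if j == N then g1 else 0.

Definition regular_local (f : R -> R[i]) g0 g1 j u : Prop :=
  weak_solution P (xprev j) (xnext j)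
    (regular_distr (xprev j) (xnext j) (fun t => f t * (hat j t)%:C))
    (left_data g0 j) (right_data g1 j) u.

Definition dirac_local j v : Prop :=
  weak_solution P (xprev j) (xnext j) (dirac_distr (x j)) 0 0 v.

Definition tilde_delta (v : nat -> R -> R[i]) j : distribution :=
  Lop P 0 1 (zero_ext j (v j)).

Definition linking_system (u v : nat -> R -> R[i]) (mu : nat -> R[i]) : Prop :=
  distr_eq 0 1
    (fun phi => \sum_(1 <= j < N) mu j * tilde_delta v j phi)
    (fun phi => - \sum_(1 <= j < N)
       (flux_right_end (x j) (zero_ext j.-1 (u j.-1))
        + flux_left_end (x j) (zero_ext j.+1 (u j.+1)))
       * dirac_distr (x j) phi).

Definition u_f (u : nat -> R -> R[i]) t : R[i] :=
  \sum_(0 <= j < N.+1) zero_ext j (u j) t.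

Definition u_delta (v : nat -> R -> R[i]) (mu : nat -> R[i]) t : R[i] :=
  \sum_(1 <= j < N) mu j * zero_ext j (v j) t.

End Decomposition.

(* Main.v *)
Require Import Defs.
From HB Require Import structures.
From mathcomp Require Import all_boot all_order all_algebra.
From mathcomp Require Import all_classical all_reals all_analysis.
From mathcomp Require Import complex.
From mathcomp Require Import measurable_realfun ess_sup_inf ring lra.
Import Order.TTheory GRing.Theory Num.Theory.
Import numFieldNormedType.Exports.

(** Why the decomposition works.

    On a subinterval (c, d), let u solve L u = s delta_y + g weakly. By the du Bois-Reymond
    lemma u is a primitive of its weak derivative, and the flux a u' is a primitive of
    g - kappa^2 u apart from a jump s at y. Hence the flux has essential limits at c and d,
    and integrating by parts against a smooth function that does not vanish at the ends
    yields a Green identity with these limits as boundary terms (weak_flux). For the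
    extension of u by zero, the identity says that L applied to it on (0, 1) is
    s delta_y + g plus Dirac masses at c and d weighted by the fluxes (local_ext).

    Because the hat functions add up to 1 (hat_sum), applying L to the sum u_f of the
    extended regular solutions gives f plus Dirac masses at the interior nodes, and the
    linking system asks exactly that L u_delta cancel them. Boundary conditions are linear
    in u, and only the extreme local problems carry the data g0 and g1, so they add up as
    well (weak_linear, weak_sum). This proves that U = u_f + u_delta is a weak solution;
    the solvability hypothesis on (0, 1), applied to differences, makes it the only one.

    The right-hand sides delta~_j = L v~_j are combinations of the Dirac masses at the
    interior nodes, as many as there are unknowns. So the linking system is a square linear
    system, and it has a unique solution once it is injective (square_system). Suppose that
    sum_j m_j delta~_j = 0. Then sum_j m_j v~_j solves the homogeneous problem on (0, 1)
    and vanishes. If m_i = 0 for i < j, then on the cell (x_{j-1}, x_j) this sum is m_j v_j;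
    were m_j non-zero, v_j would vanish there, in particular at x_j, hence also on
    (x_j, x_{j+1}) by unique solvability on that cell, which contradicts L v_j = delta_{x_j}
    (dirac_left_zero, linking_inj).

    The analysis rests on three facts: the fundamental lemma of the calculus of variations
    (fundamental_lemma), tested with explicit smooth bumps; integration by parts for
    primitives of integrable functions, which is Fubini on a triangle (prim_ibp); and their
    consequence du_bois_reymond. Complex functions are treated through their real and
    imaginary parts. *)

Set Implicit Arguments.
Unset Strict Implicit.
Unset Printing Implicit Defensive.

Local Open Scope classical_set_scope.
Local Open Scope ring_scope.

(** * Smooth functions and compactly supported bumps *)

Section Smooth.
Context {R : realType}.
Implicit Types (f g h : R -> R).

Definition smooth f := forall n (t : R), derivable (derive1n n f) t 1.

(** Coinduction: a family of differentiable functions that is stable under derivation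
    consists of smooth functions. *)
Lemma smooth_ind (Q : (R -> R) -> Prop) f :
  (forall g, Q g -> (forall t : R, derivable g t 1) /\ Q (derive1 g)) -> Q f -> smooth f.
Proof.
move=> Qd Qf n; have : Q (derive1n n f) by elim: n => // n IH; have [] := Qd _ IH.
by move=> /Qd [].
Qed.

Lemma smooth_derivable f t : smooth f -> derivable f t 1.
Proof. by move=> /(_ 0%N t). Qed.

Lemma smooth_derive1 f : smooth f -> smooth (derive1 f).
Proof. by move=> sf n t; rewrite -derive1Sn; exact: sf. Qed.

Lemma smooth_is_derive f t : smooth f -> is_derive t (1 : R) f (derive1 f t).
Proof. by move=> sf; rewrite derive1E; apply: derivableP; exact: smooth_derivable. Qed.

Lemma smooth_continuous f : smooth f -> continuous f.
Proof.
by move=> sf t; apply: differentiable_continuous; exact/derivable1_diffP/smooth_derivable.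
Qed.

(** The derivative of a product is not a product but a sum of products, so the family
    fed to the coinduction principle has to be the whole algebra generated by the
    smooth functions. *)
Inductive smooth_alg : (R -> R) -> Prop :=
| smooth_alg_base f of smooth f : smooth_alg f
| smooth_alg_add f g of smooth_alg f & smooth_alg g : smooth_alg (fun t => f t + g t)
| smooth_alg_mul f g of smooth_alg f & smooth_alg g : smooth_alg (fun t => f t * g t).

Lemma smooth_alg_smooth f : smooth_alg f -> smooth f.
Proof.
apply: smooth_ind => {}f; elim=> {f}[f sf|f g _ [df Qf] _ [dg Qg]|f g af [df Qf] ag [dg Qg]].
- by split=> [t|]; [exact: smooth_derivable|exact/smooth_alg_base/smooth_derive1].
- split=> [t|]; first exact: derivableD.
  have -> : derive1 (fun t => f t + g t) = fun t => derive1 f t + derive1 g t.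
    by apply/funext => t; rewrite !derive1E deriveD.
  exact: smooth_alg_add.
- split=> [t|]; first exact: derivableM.
  have -> : derive1 (fun t => f t * g t) = fun t => f t * derive1 g t + g t * derive1 f t.
    by apply/funext => t; rewrite !derive1E deriveM.
  by apply: smooth_alg_add; exact: smooth_alg_mul.
Qed.

Lemma smoothM f g : smooth f -> smooth g -> smooth (fun t => f t * g t).
Proof. by move=> sf sg; apply: smooth_alg_smooth; apply: smooth_alg_mul;
    exact: smooth_alg_base. Qed.

Lemma smoothD f g : smooth f -> smooth g -> smooth (fun t => f t + g t).
Proof. by move=> sf sg; apply: smooth_alg_smooth; apply: smooth_alg_add;
    exact: smooth_alg_base. Qed.

Lemma smooth_cst (k : R) : smooth (fun=> k).
Proof.
apply: (@smooth_ind (fun f => exists k, f = fun=> k)); last by exists k.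
move=> _ [c ->]; split=> [t|]; first exact: derivable_cst.
by exists 0; apply/funext => t; rewrite derive1_cst.
Qed.

Lemma smooth_affine f (a b : R) : smooth f -> smooth (fun t => f (a * t + b)).
Proof.
move=> sf; apply: (@smooth_ind (fun h => exists k g, smooth g /\ h = fun t => k * g (a * t + b))).
  move=> _ [k [g [sg ->]]].
  have D t : is_derive t (1 : R) (fun t => k * g (a * t + b)) (k * a * derive1 g (a * t + b)).
    have Da : is_derive t (1:R) (fun t : R => a * t + b) a.
      by apply: is_derive_eq; rewrite addr0 /GRing.scale /= mulr1.
    have Dg := @is_derive1_comp _ g (fun t => a * t + b) t _ _ (smooth_is_derive _ sg) Da.
    have := @is_deriveZ _ _ _ _ k _ _ _ Dg => Dk.
    by apply: is_derive_eq; rewrite /GRing.scale /=; ring.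
  split=> [t|]; first exact: (@ex_derive _ _ _ _ _ _ _ (D t)).
  exists (k * a), (derive1 g); split; first exact: smooth_derive1.
  by apply/funext => t; rewrite derive1E (@derive_val _ _ _ _ _ _ _ (D t)).
by exists 1, f; split=> //; apply/funext => t; rewrite mul1r.
Qed.

(** The classical flat functions p(1/t) exp(-1/t). Allowing all polynomials p makes the
    family stable under derivation, since (p(1/t) exp(-1/t))' = q(1/t) exp(-1/t) with q
    = X^2 (p - p'). *)
Definition poly_expN (p : {poly R}) (t : R) : R :=
  if 0 < t then p.[t^-1] * expR (- t^-1) else 0.

Lemma expRN_le_expn (y : R) n : 0 < y -> expR (- y) <= n.+1`!%:R * y ^- n.+1.
Proof.
move=> y0; have := expR_ge1Dxn n (ltW y0).
have -> : n.+1`!%:R * y ^- n.+1 = (y ^+ n.+1 / n.+1`!%:R)^-1 by rewrite invfM invrK mulrC.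
rewrite expRN lef_pV2 ?posrE ?expR_gt0 ?divr_gt0 ?exprn_gt0 ?ltr0n ?fact_gt0//.
by apply: le_trans; rewrite lerDr.
Qed.

(** Quadratic decay at 0 is what makes the difference quotients at 0 tend to 0. *)
Lemma horner_expRN_bound (p : {poly R}) :
  exists2 M : R, 0 < M & forall t : R, 0 < t -> t <= 1 ->
    `|p.[t^-1] * expR (- t^-1)| <= M * t ^+ 2.
Proof.
exists (1 + \sum_(i < size p) `|p`_i| * (i.+2)`!%:R).
  by rewrite ltr_wpDr ?sumr_ge0// => i _; rewrite mulr_ge0.
move=> t t0 t1; rewrite mulrDl mul1r ler_wpDl ?sqr_ge0//; rewrite horner_coef mulr_suml mulr_suml.
apply: (le_trans (ler_norm_sum _ _ _)); apply: ler_sum => i _.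
rewrite normrM normrM (ger0_norm (expR_ge0 _)) -!mulrA ler_wpM2l//.
have ti0 : 0 < t^-1 by rewrite invr_gt0.
have := expRN_le_expn i.+1 ti0; rewrite -exprVn invrK => H.
rewrite normrX gtr0_norm//.
apply: (@le_trans _ _ (t^-1 ^+ i * (i.+2`!%:R * t ^+ i.+2))).
  by rewrite ler_wpM2l// exprn_ge0// ltW.
rewrite mulrCA ler_wpM2l// -addn2 exprD mulrA -exprMn mulVf ?gt_eqF//.
by rewrite expr1n mul1r.
Qed.

Lemma poly_expN_is_derive p (t : R) :
  is_derive t (1 : R) (poly_expN p) (poly_expN (('X^2) * (p - p^`())) t).
Proof.
have [t0|t0|->] := ltrgtP t 0.
- have -> : poly_expN ('X^2 * (p - p^`())) t = 0 by rewrite /poly_expN ltNge (ltW t0).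
  apply: (@near_eq_is_derive _ _ _ (cst 0)).
  near=> s; rewrite /poly_expN ifF//; apply/negbTE; rewrite -leNgt ltW//.
  by near: s; exact: lt_nbhsl.
- have DV : is_derive t (1 : R) (fun s : R => s^-1) (- t ^- 2).
    have := @is_deriveV _ id t 1 1 (lt0r_neq0 t0) (is_derive_id _ _).
    by rewrite /GRing.scale /= mulr1.
  have Dp := @is_derive1_comp _ (horner p) (fun s => s^-1) t _ _ (is_derive_poly p t^-1) DV.
  have DN := @is_derive1_comp _ expR (fun s => - s^-1) t _ _ (is_derive_expR (- t^-1))
      (is_deriveN DV).
  have := is_deriveM Dp DN => D.
  have E : {near t, (horner p \o (fun s => s^-1)) * (expR \o (fun s => - s^-1)) =1 poly_expN p}.
    near=> s; rewrite /poly_expN ifT//.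
    by near: s; exact: lt_nbhsr.
  have := near_eq_is_derive E D => {}D.
  apply: is_derive_eq; rewrite /poly_expN t0 /GRing.scale /=.
  by rewrite hornerM hornerXn hornerD hornerN exprVn; ring.
- have -> : poly_expN ('X^2 * (p - p^`())) 0 = 0 by rewrite /poly_expN ltxx.
  have [M M0 HM] := horner_expRN_bound p.
  suff H : h^-1 *: (poly_expN p (h *: (1:R) + 0) - poly_expN p 0) @[h --> 0^'] --> (0 : R).
    by apply: DeriveDef; [apply/cvg_ex; exists 0|exact: (cvg_lim (@Rhausdorff R) H)].
  apply/cvgr0Pnorm_le => /= e e0; near=> h.
  have -> : poly_expN p 0 = 0 by rewrite /poly_expN ltxx.
  rewrite addr0 [h *: 1]mulr1 subr0.
  rewrite /poly_expN; case: ifPn => [h0|_]; last by rewrite scaler0 normr0 ltW.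
  have h1 : h <= 1.
    apply: (le_trans (ler_norm _)); near: h; apply: dnbhs0_le; exact: ltr01.
  rewrite normrM; apply: (@le_trans _ _ (`|h^-1| * (M * h ^+ 2))).
    by rewrite ler_wpM2l// HM.
  rewrite gtr0_norm ?invr_gt0// mulrCA mulrA expr2 mulrA.
  rewrite -(mulrA M) mulVf ?gt_eqF// mulr1.
  rewrite mulrC -ler_pdivlMr//.
  by apply: (le_trans (ler_norm _)); near: h; apply: dnbhs0_le; rewrite divr_gt0.
Unshelve. all: by end_near. Qed.

Lemma poly_expN_smooth p : smooth (poly_expN p).
Proof.
apply: (@smooth_ind (fun f => exists p, f = poly_expN p)); last by exists p.
move=> _ [q ->]; split=> [t|].
  exact: (@ex_derive _ _ _ _ _ _ _ (poly_expN_is_derive q t)).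
exists (('X^2) * (q - q^`())); apply/funext => t.
by rewrite derive1E (@derive_val _ _ _ _ _ _ _ (poly_expN_is_derive q t)).
Qed.

Definition smooth_step : R -> R := poly_expN 1.

Lemma smooth_step_smooth : smooth smooth_step. Proof. exact: poly_expN_smooth. Qed.

Lemma smooth_step_le0 t : t <= 0 -> smooth_step t = 0.
Proof. by move=> t0; rewrite /smooth_step /poly_expN ltNge t0. Qed.

Lemma smooth_step_gt0 t : 0 < t -> smooth_step t = expR (- t^-1).
Proof. by move=> t0; rewrite /smooth_step /poly_expN t0 hornerE mul1r. Qed.

Lemma smooth_step_itv t : 0 <= smooth_step t <= 1.
Proof.
have [t0|t0] := leP t 0; first by rewrite smooth_step_le0// lexx ler01.
by rewrite smooth_step_gt0// expR_ge0 expR_le1 oppr_le0 invr_ge0 ltW.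
Qed.

Lemma smooth_step_cvg t : 0 < t -> smooth_step (n.+1%:R * t) @[n --> \oo] --> (1 : R).
Proof.
move=> t0.
have -> : (fun n => smooth_step (n.+1%:R * t)) = (fun n => expR (- (n.+1%:R^-1 * t^-1))).
  by apply/funext => n; rewrite smooth_step_gt0 ?mulr_gt0// invfM.
rewrite -[X in _ --> X]expR0; apply: continuous_cvg; first exact: continuous_expR.
rewrite -[X in _ --> X]oppr0; apply: cvgN; rewrite -[X in _ --> X](mul0r t^-1).
by apply: cvgM; [exact: cvg_harmonic|exact: cvg_cst].
Qed.

(** A smooth approximation of the indicator of the interval (p, q). Rescaling the
    argument by n + 1 keeps the support in [p, q] and the values in [0, 1] while it
    forces pointwise convergence, as dominated convergence requires. *)
Definition smooth_bump (p q : R) n t : R :=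
  smooth_step (n.+1%:R * (t - p)) * smooth_step (n.+1%:R * (q - t)).

Lemma smooth_bump_test c d p q n : c < p -> q < d -> test_function c d (smooth_bump p q n).
Proof.
move=> cp qd; split.
  have -> : smooth_bump p q n = fun t => smooth_step (n.+1%:R * t + - (n.+1%:R * p)) *
      smooth_step (- n.+1%:R * t + n.+1%:R * q).
    by apply/funext => t; rewrite /smooth_bump; congr (smooth_step _ * smooth_step _); ring.
  by apply: (@smoothM _ _); apply: smooth_affine; exact: smooth_step_smooth.
exists p, q; split=> // t; rewrite in_itv /= negb_and -!ltNge => /orP[tp|qt].
  by rewrite /smooth_bump smooth_step_le0 ?mul0r// pmulr_rle0// subr_le0 ltW.
by rewrite /smooth_bump mulrC smooth_step_le0 ?mul0r// pmulr_rle0// subr_le0 ltW.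
Qed.

Lemma smooth_bump_itv p q n t : 0 <= smooth_bump p q n t <= 1.
Proof.
have /andP[a0 a1] := smooth_step_itv (n.+1%:R * (t - p)).
have /andP[b0 b1] := smooth_step_itv (n.+1%:R * (q - t)).
by rewrite mulr_ge0//= mulr_ile1.
Qed.

Lemma smooth_bump_gt0 p q n t : p < t < q -> 0 < smooth_bump p q n t.
Proof.
move=> /andP[pt tq]; rewrite /smooth_bump.
by apply: mulr_gt0; rewrite smooth_step_gt0 ?expR_gt0// mulr_gt0// subr_gt0.
Qed.

Lemma smooth_bump_cvg p q t : smooth_bump p q n t @[n --> \oo] --> (\1_`]p, q[ t : R).
Proof.
rewrite indicE; have [|] := boolP (t \in _).
  rewrite inE /= in_itv /= => /andP[pt tq].
  by rewrite -(mulr1 1); apply: cvgM; apply: smooth_step_cvg; rewrite subr_gt0.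
rewrite notin_setE /= in_itv /= => /negP; rewrite negb_and -!leNgt => H.
rewrite (_ : (fun n => _) = cst 0); first exact: cvg_cst.
apply/funext => n /=; case/orP: H => H.
  by rewrite /smooth_bump smooth_step_le0 ?mul0r// pmulr_rle0// subr_le0.
by rewrite /smooth_bump mulrC smooth_step_le0 ?mul0r// pmulr_rle0// subr_le0.
Qed.

End Smooth.

(** * Test functions and the fundamental lemma *)

Section TestFunctions.
Context {R : realType}.
Implicit Types (f g h phi : R -> R).
Local Notation mu := (@lebesgue_measure R).

Lemma test_smooth (c d : R) phi : test_function c d phi -> smooth phi.
Proof. by case. Qed.

Lemma test_continuous (c d : R) phi : test_function c d phi -> continuous phi.
Proof. by move=> /test_smooth/smooth_continuous. Qed.

Lemma test_widen (c d c' d' : R) phi : c' <= c -> d <= d' ->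
  test_function c d phi -> test_function c' d' phi.
Proof.
move=> c'c dd' [sphi [p [q [cp qd phi0]]]]; split=> //; exists p, q.
by split=> //; [exact: le_lt_trans cp|exact: lt_le_trans dd'].
Qed.

Lemma test_out (c d : R) phi t : test_function c d phi -> ~~ (c < t < d) -> phi t = 0.
Proof.
move=> [_ [p [q [cp qd phi0]]]] /negP tcd; apply: phi0; rewrite in_itv/=.
by apply/negP => /andP[pt tq]; apply: tcd; rewrite (lt_le_trans cp)//= (le_lt_trans tq).
Qed.

Lemma test_derive1 (c d : R) phi : test_function c d phi -> test_function c d (derive1 phi).
Proof.
move=> [sphi [p [q [cp qd phi0]]]]; split; first exact: smooth_derive1.
exists p, q; split=> // t; rewrite in_itv/= negb_and -!ltNge derive1E => tpq.
rewrite (@near_eq_derive _ _ _ _ (cst 0)) ?derive_cst//.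
case/orP: tpq => tpq; near=> s; apply: phi0; rewrite in_itv/= negb_and -!ltNge.
  by apply/orP; left; near: s; exact: lt_nbhsl.
by apply/orP; right; near: s; exact: lt_nbhsr.
Unshelve. all: by end_near. Qed.

Lemma continuous_integrable_oo (c d : R) f : continuous f ->
  mu.-integrable `]c, d[ (EFin \o f).
Proof.
move=> cf; have fi : mu.-integrable `[c, d] (EFin \o f).
  apply: continuous_compact_integrable; first exact: segment_compact.
  exact: continuous_subspaceT.
by apply: integrableS fi => //; exact: subset_itv_oo_cc.
Qed.

Lemma ae_imp (P Q : R -> Prop) : (forall t, P t -> Q t) ->
  {ae mu, forall t, P t} -> {ae mu, forall t, Q t}.
Proof. by move=> PQ; apply: filterS => //; exact: (ae_filter_ringOfSetsType mu). Qed.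

Lemma ae_all (P : R -> Prop) : (forall t, P t) -> {ae mu, forall t, P t}.
Proof. by move=> PT; exact: aeW. Qed.

Lemma ae_imp2 (P Q S : R -> Prop) : (forall t, P t -> Q t -> S t) ->
  {ae mu, forall t, P t} -> {ae mu, forall t, Q t} -> {ae mu, forall t, S t}.
Proof. by move=> PQ; apply: filterS2 => //; exact: (ae_filter_ringOfSetsType mu). Qed.

Lemma integrable_funD (D : set R) f g : measurable D ->
  mu.-integrable D (EFin \o f) -> mu.-integrable D (EFin \o g) ->
  mu.-integrable D (EFin \o (fun t => f t + g t)).
Proof.
move=> mD fi gi.
have -> : EFin \o (fun t => f t + g t) = ((EFin \o f) \+ (EFin \o g))%E by apply/funext.
exact: integrableD.
Qed.

Lemma integrable_funB (D : set R) f g : measurable D ->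
  mu.-integrable D (EFin \o f) -> mu.-integrable D (EFin \o g) ->
  mu.-integrable D (EFin \o (fun t => f t - g t)).
Proof.
move=> mD fi gi.
have -> : EFin \o (fun t => f t - g t) = ((EFin \o f) \- (EFin \o g))%E by apply/funext.
exact: integrableB.
Qed.

Lemma integrable_funZ (D : set R) k f : measurable D ->
  mu.-integrable D (EFin \o f) -> mu.-integrable D (EFin \o (fun t => k * f t)).
Proof.
move=> mD fi.
have -> : EFin \o (fun t => k * f t) = (fun t => k%:E * (EFin \o f) t)%E by apply/funext.
exact: integrableZl.
Qed.

(** The bound is only almost everywhere, which is what membership in a Lebesgue space
    of exponent infinity provides. *)
Lemma integrable_ae_bounded (D : set R) f (b : R -> R) (M : R) :
  measurable D -> mu.-integrable D (EFin \o f) -> measurable_fun D b ->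
  {ae mu, forall t, D t -> `|b t| <= M} ->
  mu.-integrable D (EFin \o (fun t => f t * b t)).
Proof.
move=> mD /[dup] /integrable_norm fni /integrableP[mf fi] mb bM.
have mfb : measurable_fun D (fun t => f t * b t).
  by apply: measurable_funM => //; exact/measurable_EFinP.
apply/integrableP; split; first exact/measurable_EFinP.
have /integrableP[mMf Mf] : mu.-integrable D (fun t => M%:E * `|f t|%:E)%E.
  exact: integrableZl.
apply: le_lt_trans (Mf); apply: ae_ge0_le_integral => //.
- by do 2 apply: measurableT_comp => //.
- by apply: measurableT_comp.
apply: ae_imp bM => t bM Dt /=; rewrite lee_fin (le_trans _ (ler_norm _))//.
by rewrite normrM mulrC ler_wpM2r// bM.
Qed.

Lemma integrable_continuousM (c d : R) f (b : R -> R) : continuous b ->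
  mu.-integrable `]c, d[ (EFin \o f) ->
  mu.-integrable `]c, d[ (EFin \o (fun t => f t * b t)).
Proof.
move=> cb fi; have [dc|cd] := ltP d c.
  by rewrite set_itv_ge ?bnd_simp -?leNgt ?ltW//; exact: integrable_set0.
have [|e _ eM] := @EVT_max R (fun t => `|b t|) c d cd.
  by apply: continuous_subspaceT => t; apply: continuous_comp; [exact: cb|exact: norm_continuous].
apply: (@integrable_ae_bounded _ _ _ `|b e|) => //.
  by apply: measurable_funTS; exact: continuous_measurable_fun.
by apply: ae_all => t /subset_itv_oo_cc /eM.
Qed.

(** Testing against bumps that converge to the indicator of (p, q) shows that the
    integral of g over every interval compactly inside (c, d) vanishes. The primitive
    of g is then locally constant, and its derivative is g at almost every point by
    Lebesgue differentiation. *)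
Lemma fundamental_lemma (c d : R) g : mu.-integrable `]c, d[ (EFin \o g) ->
  (forall phi, test_function c d phi -> \int[mu]_(t in `]c, d[) (g t * phi t) = 0) ->
  {ae mu, forall t, c < t < d -> g t = 0}.
Proof.
move=> gi g0.
have mg : measurable_fun `]c, d[ g by apply/measurable_EFinP; case/integrableP : gi.
have gpq p q : c < p -> q < d -> \int[mu]_(t in `]p, q[) g t = 0.
  move=> cp qd.
  have pqcd : `]p, q[ `<=` `]c, d[ by apply: subset_itvW; exact: ltW.
  pose F n := EFin \o (fun t => g t * smooth_bump p q n t).
  pose F0 := EFin \o (fun t => g t * \1_`]p, q[ t).
  have mb n : measurable_fun `]c, d[ (smooth_bump p q n).
    apply: measurable_funTS; apply: continuous_measurable_fun.
    exact: (test_continuous (smooth_bump_test n cp qd)).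
  have [] := @dominated_convergence _ _ _ mu `]c, d[%classic _ F F0 (fun t => `|g t|%:E).
  - by [].
  - by move=> n; apply/measurable_EFinP; apply: measurable_funM => //; exact: mb.
  - by apply/measurable_EFinP; apply: measurable_funM => //; exact: measurable_indic.
  - apply: ae_all => t _; apply: cvg_EFin; first exact: nearW.
    by apply: cvgM; [exact: cvg_cst|exact: smooth_bump_cvg].
  - exact: integrable_norm.
  - apply: ae_all => t n _ /=; rewrite lee_fin normrM ler_piMr//.
    by have /andP[b0 b1] := smooth_bump_itv p q n t; rewrite ger0_norm.
  move=> F0i _ FF0.
  have : (\int[mu]_(x in `]c, d[) F n x)%E @[n --> \oo] --> 0%E.
    rewrite (_ : (fun n => _) = cst 0%E); first exact: cvg_cst.
    apply/funext => n; rewrite -[RHS]/((0 : R)%:E) -(g0 _ (smooth_bump_test n cp qd)).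
    rewrite /Rintegral fineK//; apply: integrable_fin_num => //.
    apply: (@integrable_ae_bounded _ _ _ 1) => //.
    by apply: ae_all => t _; have /andP[b0 b1] := smooth_bump_itv p q n t; rewrite ger0_norm.
  move=> I0; have F00 : (\int[mu]_(x in `]c, d[) F0 x = 0)%E.
    exact: (cvg_unique (@ereal_hausdorff R) FF0 I0).
  rewrite /Rintegral (_ : (\int[mu]_(x in _) _)%E = 0%E)// -F00.
  rewrite -{1}(setIidr pqcd) integral_mkcondr; apply: eq_integral => t _.
  by rewrite /F0 /= indicE patchE; case: ifP => _; rewrite ?mulr1 ?mulr0.
pose h := g \_ `]c, d[.
have hi : mu.-integrable setT (EFin \o h).
  by rewrite /h -restrict_EFin -integrable_mkcond.
have hiS D : measurable D -> mu.-integrable D (EFin \o h).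
  by move=> mD; apply: integrableS hi.
have := @FTC1Ny R h (fun y => hiS _ (measurable_itv _)) (integrable_locally (measurable_itv _)
    gi).
set F := fun x => _.
apply: ae_imp => t [dF F't] /andP[ct td].
have <- : h t = g t by rewrite /h patchE mem_set//= in_itv/= ct td.
rewrite -F't derive1E.
set p := (c + t) / 2.
have cp : c < p by rewrite /p; lra.
have pt : p < t by rewrite /p; lra.
rewrite (@near_eq_derive _ _ _ _ (cst (F p))) ?derive_cst//.
near=> y.
have py : p < y by near: y; exact: lt_nbhsr.
have yd : y < d by near: y; exact: lt_nbhsl.
apply/eqP; rewrite -subr_eq0; apply/eqP.
have /= := @Rintegral_itvB R h -oo%O (BRight y) p (hiS _ (measurable_itv _)) => ->//; last first.
  by rewrite bnd_simp ltW.
rewrite -Rintegral_itv_bndo_bndc; last exact: hiS.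
rewrite -[RHS](gpq p y cp yd); apply: eq_Rintegral => s; rewrite inE/= in_itv/= => /andP[ps sy].
by rewrite /h patchE mem_set//= in_itv/= (lt_trans cp)//= (lt_trans sy).
Unshelve. all: by end_near. Qed.

End TestFunctions.

(** * Primitives of integrable functions *)

Section Primitive.
Context {R : realType}.
Implicit Types (f g h phi : R -> R).
Local Notation mu := (@lebesgue_measure R).

Definition prim (c : R) g (t : R) : R := \int[mu]_(s in `]c, t[) g s.

Lemma prim_restrict c d g t : t <= d -> prim c g t = prim c (g \_ `]c, d[) t.
Proof.
move=> td; apply: eq_Rintegral => s; rewrite inE /= in_itv /= => /andP[cs st].
by rewrite patchE mem_set//= in_itv/= cs (lt_le_trans st).
Qed.

Lemma integrable_restrictT (c d : R) g : mu.-integrable `]c, d[ (EFin \o g) ->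
  mu.-integrable setT (EFin \o (g \_ `]c, d[)).
Proof. by move=> gi; rewrite -restrict_EFin -integrable_mkcond. Qed.

Lemma integrable_sub (c d p q : R) g : c <= p -> q <= d ->
  mu.-integrable `]c, d[ (EFin \o g) -> mu.-integrable `]p, q[ (EFin \o g).
Proof. by move=> cp qd; apply: integrableS => //; exact: subset_itvW. Qed.

Lemma prim_continuous c d g : mu.-integrable `]c, d[ (EFin \o g) ->
  {within `[c, d], continuous (prim c g)}.
Proof.
move=> gi; have [dc|cd] := ltP d c.
  by rewrite set_itv_ge ?bnd_simp -?ltNge//; exact: continuous_subspace0.
pose h := g \_ `]c, d[.
have hi D : measurable D -> mu.-integrable D (EFin \o h).
  by move=> mD; apply: integrableS (integrable_restrictT gi).
apply: (@subspace_eq_continuous _ _ _ (fun t => parameterized_integral mu c t h)); last first.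
  by apply: parameterized_integral_continuous => //; exact: hi.
move=> t; rewrite inE/= in_itv/= => /andP[ct td].
transitivity (prim c h t); last exact/esym/prim_restrict.
rewrite /prim /parameterized_integral.
rewrite Rintegral_itv_bndo_bndc; last exact: hi.
by rewrite Rintegral_itv_obnd_cbnd; last exact: hi.
Qed.

Lemma Rintegral_derive1 (c d : R) phi : smooth phi -> c <= d ->
  \int[mu]_(t in `]c, d[) derive1 phi t = phi d - phi c.
Proof.
move=> sphi; rewrite le_eqVlt => /predU1P[<-|cd].
  by rewrite set_itv_ge ?bnd_simp// Rintegral_set0 subrr.
have cphi' := smooth_continuous (smooth_derive1 sphi).
have cphi := smooth_continuous sphi.
have i0 : mu.-integrable `[c, d] (EFin \o derive1 phi).
  apply: continuous_compact_integrable; first exact: segment_compact.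
  exact: continuous_subspaceT.
rewrite Rintegral_itv_bndo_bndc; last exact: continuous_integrable_oo.
rewrite Rintegral_itv_obnd_cbnd; last first.
  by apply: integrableS i0 => //; apply: subset_itvr; rewrite bnd_simp.
rewrite /Rintegral (@continuous_FTC2 _ _ phi)//.
- exact: continuous_subspaceT.
- split.
  + by move=> t _; exact: smooth_derivable.
  + by apply: cvg_at_right_filter; exact: cphi.
  + by apply: cvg_at_left_filter; exact: cphi.
Qed.

(** The dominating function for the use of Fubini's theorem in prim_ibp. *)
Lemma integrable_prod_fun f g :
  mu.-integrable setT (EFin \o f) -> mu.-integrable setT (EFin \o g) ->
  (mu \x mu)%E.-integrable setT (fun z : R * R => (f z.1 * g z.2)%:E).
Proof.
move=> /[dup] /integrableP[mf fi] fI /[dup] /integrableP[mg gi] gI.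
have mf' : measurable_fun setT f by exact/measurable_EFinP.
have mg' : measurable_fun setT g by exact/measurable_EFinP.
have mag : measurable_fun setT (fun t => `|g t|%:E) by apply/measurable_EFinP;
    exact: measurableT_comp mg'.
have maf : measurable_fun setT (fun t => `|f t|%:E) by apply/measurable_EFinP;
    exact: measurableT_comp mf'.
apply/integrable12ltyP.
  apply/measurable_EFinP; apply: measurable_funM.
    exact: (measurableT_comp mf' measurable_fst).
  exact: (measurableT_comp mg' measurable_snd).
under eq_integral.
  move=> t _; under eq_integral do rewrite /= normrM EFinM.
  rewrite ge0_integralZl//=.
  over.
have If : (\int[mu]_x `|(EFin \o g) x| \is a fin_num)%E by rewrite ge0_fin_numE// integral_ge0.
rewrite /= -(fineK If).
rewrite ge0_integralZr//=; last by rewrite lee_fin fine_ge0// integral_ge0.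
by rewrite lte_mul_pinfty ?integral_ge0 ?ltry// ge0_fin_numE ?integral_ge0//.
Qed.

(** Integration by parts where one factor is only absolutely continuous. It is Fubini's
    theorem for g(s) phi'(t) on the triangle s < t: integrating first in s gives the
    left-hand side, integrating first in t replaces phi' by phi(d) - phi(s). *)
Lemma prim_ibp (c d : R) g phi : c <= d -> mu.-integrable `]c, d[ (EFin \o g) ->
  smooth phi ->
  \int[mu]_(t in `]c, d[) (prim c g t * derive1 phi t) =
  prim c g d * phi d - \int[mu]_(t in `]c, d[) (g t * phi t).
Proof.
move=> cd gi sphi.
have cphi' := smooth_continuous (smooth_derive1 sphi).
have cphi := smooth_continuous sphi.
pose h := g \_ `]c, d[; pose psi := derive1 phi \_ `]c, d[.
have hi := integrable_restrictT gi.
have psii := integrable_restrictT (continuous_integrable_oo c d cphi').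
(* The factor (s < t) cuts out the triangle; psi and h vanish outside (c, d). *)
pose k (z : R * R) := psi z.1 * h z.2 * (z.2 < z.1)%R%:R.
have ki : (mu \x mu)%E.-integrable setT (EFin \o k).
  have phi_i := integrable_prod_fun psii hi.
  apply: le_integrable (phi_i) => //.
    apply/measurable_EFinP; apply: measurable_funM.
      by apply/measurable_EFinP; exact: (measurable_int _ phi_i).
    apply: (@measurableT_comp _ _ _ _ _ _ (fun b : bool => (b : nat)%:R : R)) => //.
    exact: measurable_fun_ltr.
  move=> z _; rewrite lee_fin normrM ler_piMr// ger0_norm//.
  by rewrite lern1 leq_b1.
have inner1 t : (\int[mu]_s (EFin \o k) (t, s) =
    (((fun t => prim c g t * derive1 phi t) \_ `]c, d[) t)%:E)%E.
  have [|tcd] := boolP (t \in `]c, d[%classic); last first.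
    rewrite /k /psi patchE (negbTE tcd) /= [in LHS]patchE (negbTE tcd).
    by under eq_integral do rewrite !mul0r; rewrite integral0.
  rewrite inE/= in_itv/= => /andP[ct td].
  have Pi : mu.-integrable `]c, t[ (EFin \o g) by apply: integrable_sub gi => //; exact: ltW.
  have E s : (EFin \o k) (t, s) = ((derive1 phi t)%:E * ((g \_ `]c, t[) s)%:E)%E.
    rewrite /k /= /psi patchE mem_set/= ?in_itv/= ?ct//  -EFinM -mulrA; congr (_ * _)%:E.
    rewrite /h !patchE !mem_setE !in_itv/=; case: (ltP s t) => st.
      by rewrite (lt_trans st td) andbT mulr1.
    by rewrite andbF mulr0.
  transitivity (\int[mu]_s ((derive1 phi t)%:E * ((g \_ `]c, t[) s)%:E))%E.
    by apply: eq_integral => s _; exact: E.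
  rewrite integralZl//; last exact: integrable_restrictT.
  rewrite patchE mem_set/= ?in_itv/= ?ct// mulrC EFinM; congr (_ * _)%E.
  rewrite -[LHS]fineK; last by apply: integrable_fin_num => //; exact: integrable_restrictT.
  by rewrite /prim Rintegral_mkcond.
have inner2 s : (\int[mu]_t (EFin \o k) (t, s) =
    (((fun s => g s * (phi d - phi s)) \_ `]c, d[) s)%:E)%E.
  have [|tcd] := boolP (s \in `]c, d[%classic); last first.
    have hs : h s = 0 by rewrite /h patchE (negbTE tcd).
    rewrite patchE (negbTE tcd) /k /= hs.
    by under eq_integral do rewrite mulr0 mul0r; rewrite integral0.
  rewrite inE/= in_itv/= => /andP[cs sd].
  have Pi := continuous_integrable_oo s d cphi'.
  have E t : (EFin \o k) (t, s) = ((g s)%:E * ((derive1 phi \_ `]s, d[) t)%:E)%E.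
    rewrite /k /= /h patchE mem_set/= ?in_itv/= ?cs// -EFinM mulrAC mulrC; congr (_ * _)%:E.
    rewrite /psi !patchE !mem_setE !in_itv/=; case: (ltP s t) => st.
      by rewrite (lt_trans cs st) mulr1.
    by rewrite mulr0.
  transitivity (\int[mu]_t ((g s)%:E * ((derive1 phi \_ `]s, d[) t)%:E))%E.
    by apply: eq_integral => t _; exact: E.
  rewrite integralZl//; last exact: integrable_restrictT.
  rewrite patchE mem_set/= ?in_itv/= ?cs// EFinM; congr (_ * _)%E.
  rewrite -[LHS]fineK; last by apply: integrable_fin_num => //; exact: integrable_restrictT.
  by rewrite -(Rintegral_derive1 sphi (ltW sd)) Rintegral_mkcond.
have := Fubini ki.
under eq_integral do rewrite inner1; under [in RHS]eq_integral do rewrite inner2.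
move/(congr1 fine); rewrite -![fine _]/(Rintegral _ _ _) -!Rintegral_mkcond => ->.
under eq_Rintegral do rewrite mulrBr.
have gphi := integrable_continuousM cphi gi.
have gphid : mu.-integrable `]c, d[ (EFin \o (fun s => g s * phi d)).
  by apply: (@integrable_continuousM _ _ _ _ (cst (phi d))) => //; exact: cst_continuous.
by rewrite RintegralB// RintegralZr.
Qed.

End Primitive.

(** * The du Bois-Reymond lemma *)

Section DuBoisReymond.
Context {R : realType}.
Implicit Types (f g h w phi psi : R -> R).
Local Notation mu := (@lebesgue_measure R).

(** Intervals have positive measure; this is what makes the essential one-sided filters
    proper, hence their limits unique. *)
Lemma ae_ex (c d : R) (P : R -> Prop) : c < d -> {ae mu, forall t, P t} ->
  exists2 t, c < t < d & P t.
Proof.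
move=> cd [A [mA A0 PA]]; apply: contrapT => nP.
have : (mu `]c, d[%classic <= mu A)%E.
  apply: le_measure; rewrite ?inE//= => t; rewrite /= in_itv/= => tcd.
  by apply: PA => /= Pt; apply: nP; exists t.
by rewrite A0 lebesgue_measure_itv /= lte_fin cd -EFinD lee_fin subr_le0 leNgt cd.
Qed.

Lemma test_scale_add (c d k : R) phi psi : test_function c d phi -> test_function c d psi ->
  test_function c d (fun t => phi t + k * psi t).
Proof.
move=> [sphi [p [q [cp qd phi0]]]] [spsi [p' [q' [cp' qd' psi0]]]]; split.
  have skpsi : smooth (fun t => k * psi t) by apply: smoothM spsi; exact: smooth_cst.
  exact: smoothD sphi skpsi.
exists (Num.min p p'), (Num.max q q'); rewrite lt_min gt_max cp cp' qd qd'; split=> // t.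
rewrite in_itv/= ge_min le_max => H.
rewrite phi0 ?psi0 ?mulr0 ?addr0// in_itv/=; apply: contra H => /andP[-> ->]; rewrite ?orbT//.
Qed.

(** A mean-zero test function is the derivative of a test function: beyond its support
    the primitive is constant, with value 0 on the left, and with value the integral on
    the right. *)
Lemma test_primitive (c d : R) psi : test_function c d psi ->
  \int[mu]_(t in `]c, d[) psi t = 0 ->
  exists2 phi, test_function c d phi & derive1 phi = psi.
Proof.
move=> tpsi psi0; have [spsi [p [q [cp qd psi_out]]]] := tpsi.
have cpsi := test_continuous tpsi.
have psiE : psi \_ `]c, d[ = psi.
  apply/funext => t; rewrite patchE mem_setE in_itv/=; case: ifPn => // tcd.
  by rewrite (test_out tpsi).
have psii D : measurable D -> mu.-integrable D (EFin \o psi).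
  move=> mD; apply: (@integrableS _ _ _ _ setT) => //; rewrite -psiE.
  exact/integrable_restrictT/continuous_integrable_oo.
pose Phi t := \int[mu]_(s in `]-oo, t]) psi s.
have D t : derivable Phi t 1 /\ derive1 Phi t = psi t.
  by apply: (@continuous_FTC1 R psi -oo%O t (t + 1));
      [rewrite ltrDl|exact: psii|rewrite ltNyr|exact: cpsi].
have DPhi : derive1 Phi = psi by apply/funext => t; have [] := D t.
exists Phi; last exact: DPhi.
split.
  by case=> [|n] t; [have [] := D t|rewrite derive1Sn DPhi; exact: spsi].
exists p, q; split=> // t; rewrite in_itv/= negb_and -!ltNge => /orP[tp|qt].
  transitivity (\int[mu]_(s in `]-oo, t]) cst (0 : R) s); last by rewrite Rintegral_cst ?mul0r.
  apply: eq_Rintegral => s; rewrite inE/= in_itv/= => st; apply: psi_out;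
      rewrite in_itv/= negb_and -!ltNge.
  by rewrite (le_lt_trans st tp).
rewrite /Phi -[RHS]psi0 -psiE Rintegral_mkcond [RHS]Rintegral_mkcond psiE;
    congr (Rintegral _ _ _).
rewrite psiE; apply/funext => s; rewrite patchE mem_setE in_itv/=; case: ifPn => // st.
rewrite psi_out// in_itv/= negb_and -!ltNge; apply/orP; right.
by rewrite (lt_trans qt)// ltNge.
Qed.

Lemma integrable_cst_oo (c d k : R) : mu.-integrable `]c, d[ (EFin \o cst k).
Proof. by apply: continuous_integrable_oo; exact: cst_continuous. Qed.

Lemma prim_integrable (c d : R) g : mu.-integrable `]c, d[ (EFin \o g) ->
  mu.-integrable `]c, d[ (EFin \o prim c g).
Proof.
move=> gi; have : mu.-integrable `[c, d] (EFin \o prim c g).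
  apply: continuous_compact_integrable; first exact: segment_compact.
  exact: prim_continuous.
by apply: integrableS => //; exact: subset_itv_oo_cc.
Qed.

(** Integration by parts turns the hypothesis into the statement that h = w - prim g is
    orthogonal to all derivatives of test functions, that is, to all mean-zero test
    functions. Subtracting a suitable multiple of a fixed test function of non-zero
    mean makes any test function mean-zero, so h - C is orthogonal to every test
    function for a suitable constant C. *)
Lemma du_bois_reymond (c d : R) w g : c < d ->
  mu.-integrable `]c, d[ (EFin \o w) -> mu.-integrable `]c, d[ (EFin \o g) ->
  (forall phi, test_function c d phi ->
    \int[mu]_(t in `]c, d[) (w t * derive1 phi t) = - \int[mu]_(t in `]c, d[) (g t * phi t)) ->
  exists C, {ae mu, forall t, c < t < d -> w t = C + prim c g t}.
Proof.
move=> cd wi gi wg; have Gi := prim_integrable gi.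
pose h t := w t - prim c g t.
have hi : mu.-integrable `]c, d[ (EFin \o h) by exact: integrable_funB.
have h0 phi : test_function c d phi -> \int[mu]_(t in `]c, d[) (h t * derive1 phi t) = 0.
  move=> tphi; have cphi' := test_continuous (test_derive1 tphi).
  under eq_Rintegral do rewrite mulrBl.
  rewrite RintegralB//; last 2 first.
  - exact: integrable_continuousM.
  - exact: integrable_continuousM.
  rewrite wg// (prim_ibp (ltW cd) gi (test_smooth tphi)) (test_out tphi) ?ltxx ?andbF//.
  by rewrite mulr0 sub0r subrr.
(* Without such a theta the constant 1 would vanish almost everywhere. *)
have [theta ttheta I0] : exists2 theta, test_function c d theta &
    \int[mu]_(t in `]c, d[) theta t != 0.
  apply: contrapT => nth.
  have /(ae_ex cd)[t tcd /(_ tcd)/eqP] : {ae mu, forall t, c < t < d -> cst (1 : R) t = 0}.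
    apply: fundamental_lemma; first exact: integrable_cst_oo.
    move=> phi tphi; under eq_Rintegral do rewrite mul1r.
    by apply/eqP/negPn/negP => ?; apply: nth; exists phi.
  by rewrite oner_eq0.
set I := Rintegral _ _ _ in I0.
(* The value of h that orthogonality to psi - (J / I) theta dictates. *)
pose C := \int[mu]_(t in `]c, d[) (h t * theta t) / I.
exists C.
have ctheta := test_continuous ttheta.
have hCi : mu.-integrable `]c, d[ (EFin \o (fun t => h t - C)).
  by apply: integrable_funB => //; exact: integrable_cst_oo.
have /ae_imp : {ae mu, forall t, c < t < d -> h t - C = 0}.
  apply: fundamental_lemma => // psi tpsi.
  have cpsi := test_continuous tpsi.
  have psii := continuous_integrable_oo c d cpsi.
  have thetai := continuous_integrable_oo c d ctheta.
  set J := \int[mu]_(t in `]c, d[) psi t.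
  have [||phi tphi phi'E] := @test_primitive c d (fun t => psi t + (- (J / I)) * theta t).
  - exact: test_scale_add.
  - rewrite RintegralD//; last first.
      apply: continuous_integrable_oo => t; apply: cvgM; [exact: cvg_cst|exact: ctheta].
    by rewrite RintegralZl// -/I -/J mulNr divfK// subrr.
  have := h0 _ tphi; rewrite phi'E.
  have hpsii := integrable_continuousM cpsi hi.
  have hthetai := integrable_continuousM ctheta hi.
  under eq_Rintegral do rewrite mulrDr mulrCA.
  rewrite RintegralD//; last first.
    exact: integrable_funZ.
  rewrite RintegralZl// => H.
  under eq_Rintegral do rewrite mulrBl.
  rewrite RintegralB//; last first.
    exact: integrable_funZ.
  rewrite RintegralZl// -/J -[RHS]H; congr (_ + _).
  by rewrite /C; ring.
by apply=> t Ht /Ht; rewrite /h => /eqP; rewrite subr_eq0 subr_eq => /eqP.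
Qed.

End DuBoisReymond.

(** * Integration of complex-valued functions *)

Section ComplexIntegral.
Local Open Scope complex_scope.
Context {R : realType}.
Implicit Types (phi psi : R -> R) (u v w g h : R -> R[i]) (D : set R).
Local Notation mu := (@lebesgue_measure R).
Local Notation Re := complex.Re.
Local Notation Im := complex.Im.

Definition cintegrable D w :=
  mu.-integrable D (EFin \o (fun t => Re (w t))) /\
  mu.-integrable D (EFin \o (fun t => Im (w t))).

Lemma cReMC (z : R[i]) (r : R) : Re (z * r%:C) = Re z * r.
Proof. by case: z => a b /=; rewrite mulr0 subr0. Qed.

Lemma cImMC (z : R[i]) (r : R) : Im (z * r%:C) = Im z * r.
Proof. by case: z => a b /=; rewrite mulr0 add0r. Qed.

Lemma cReD (z z' : R[i]) : Re (z + z') = Re z + Re z'. Proof. by case: z; case: z'. Qed.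
Lemma cImD (z z' : R[i]) : Im (z + z') = Im z + Im z'. Proof. by case: z; case: z'. Qed.
Lemma cReN (z : R[i]) : Re (- z) = - Re z. Proof. by case: z. Qed.
Lemma cImN (z : R[i]) : Im (- z) = - Im z. Proof. by case: z. Qed.
Lemma cReM (z z' : R[i]) : Re (z * z') = Re z * Re z' - Im z * Im z'.
Proof. by case: z; case: z'. Qed.
Lemma cImM (z z' : R[i]) : Im (z * z') = Re z * Im z' + Im z * Re z'.
Proof. by case: z => a b; case: z' => a' b' /=; rewrite addrC. Qed.

Lemma complex_ext (z z' : R[i]) : Re z = Re z' -> Im z = Im z' -> z = z'.
Proof. by case: z => a b; case: z' => a' b' /= -> ->. Qed.

Lemma cintegrableD D u v : measurable D -> cintegrable D u -> cintegrable D v ->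
  cintegrable D (fun t => u t + v t).
Proof.
move=> mD [ur ui] [vr vi]; split.
- have -> : (fun t => Re (u t + v t)) = (fun t => Re (u t) + Re (v t)) by apply/funext => t;
    rewrite cReD.
  exact: integrable_funD.
- have -> : (fun t => Im (u t + v t)) = (fun t => Im (u t) + Im (v t)) by apply/funext => t;
    rewrite cImD.
  exact: integrable_funD.
Qed.

Lemma cintegrableZ D (k : R[i]) u : measurable D -> cintegrable D u ->
  cintegrable D (fun t => k * u t).
Proof.
move=> mD [ur ui]; split.
- have -> : (fun t => Re (k * u t)) = (fun t => Re k * Re (u t) - Im k * Im (u t)).
    by apply/funext => t; rewrite cReM.
  by apply: integrable_funB => //; exact: integrable_funZ.
- have -> : (fun t => Im (k * u t)) = (fun t => Re k * Im (u t) + Im k * Re (u t)).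
    by apply/funext => t; rewrite cImM.
  by apply: integrable_funD => //; exact: integrable_funZ.
Qed.

Lemma cintegrableMC (c d : R) w phi : continuous phi -> cintegrable `]c, d[ w ->
  cintegrable `]c, d[ (fun t => w t * (phi t)%:C).
Proof.
move=> cphi [wr wi]; split.
- have -> : (fun t => Re (w t * (phi t)%:C)) = (fun t => Re (w t) * phi t).
    by apply/funext => t; rewrite cReMC.
  exact: integrable_continuousM.
- have -> : (fun t => Im (w t * (phi t)%:C)) = (fun t => Im (w t) * phi t).
    by apply/funext => t; rewrite cImMC.
  exact: integrable_continuousM.
Qed.

Lemma cintegrableS D E u : measurable D -> measurable E -> D `<=` E -> cintegrable E u ->
    cintegrable D u.
Proof. by move=> mD mE DE [ur ui]; split; [exact: integrableS ur|exact: integrableS ui]. Qed.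

Lemma cintegralD D u v : measurable D -> cintegrable D u -> cintegrable D v ->
  cintegral D (fun t => u t + v t) = cintegral D u + cintegral D v.
Proof.
move=> mD [ur ui] [vr vi]; rewrite /cintegral.
under eq_Rintegral do rewrite cReD.
rewrite RintegralD//; under [in X in _ +i* X]eq_Rintegral do rewrite cImD.
by rewrite RintegralD.
Qed.

Lemma cintegralZ D (k : R[i]) u : measurable D -> cintegrable D u ->
  cintegral D (fun t => k * u t) = k * cintegral D u.
Proof.
move=> mD [ur ui]; rewrite /cintegral.
under eq_Rintegral do rewrite cReM.
rewrite RintegralB//; [|exact: integrable_funZ..]; rewrite !RintegralZl//.
under [in X in _ +i* X]eq_Rintegral do rewrite cImM.
rewrite RintegralD//; [|exact: integrable_funZ..]; rewrite !RintegralZl//.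
by apply: complex_ext; rewrite ?cReM ?cImM.
Qed.

Lemma eq_cintegral D u v : {in D, u =1 v} -> cintegral D u = cintegral D v.
Proof. by move=> uv; congr Complex; apply: eq_Rintegral => t tD; rewrite uv. Qed.

Lemma cintegral0 D : cintegral D (cst 0) = 0.
Proof. by rewrite /cintegral /Rintegral /= !integral0. Qed.

Lemma cintegrable0 D : cintegrable D (cst 0).
Proof. by split; exact: integrable0. Qed.

Lemma cintegral_support D E u : D `<=` E -> (forall t, E t -> ~ D t -> u t = 0) ->
  cintegral E u = cintegral D u.
Proof.
move=> DE u0.
have H (f : R[i] -> R) : f 0 = 0 -> (fun t => f (u t)) \_ E = (fun t => f (u t)) \_ D.
  move=> f0; apply/funext => t; rewrite !patchE.
  case: ifPn => tE; case: ifPn => tD //.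
    by rewrite u0//; [exact: set_mem|move: tD; rewrite notin_setE].
  by move: tE; rewrite notin_setE => -[]; apply: DE; exact: set_mem.
by congr Complex; rewrite Rintegral_mkcond [RHS]Rintegral_mkcond;
    [rewrite (H (@complex.Re R))|rewrite (H (@complex.Im R))].
Qed.

Lemma ae_eq_cintegral D u v : measurable D -> cintegrable D u -> cintegrable D v ->
  {ae mu, forall t, D t -> u t = v t} -> cintegral D u = cintegral D v.
Proof.
move=> mD [ur ui] [vr vi] uv; rewrite /cintegral /Rintegral; congr (fine _ +i* fine _).
- apply: ae_eq_integral => //; [exact: measurable_int ur|exact: measurable_int vr|].
  by apply: ae_imp uv => t uv Dt; rewrite /= uv.
- apply: ae_eq_integral => //; [exact: measurable_int ui|exact: measurable_int vi|].
  by apply: ae_imp uv => t uv Dt; rewrite /= uv.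
Qed.

Lemma Re_cintegralMC D w phi :
  Re (cintegral D (fun t => w t * (phi t)%:C)) = \int[mu]_(t in D) (Re (w t) * phi t).
Proof. by rewrite /=; under eq_Rintegral do rewrite cReMC. Qed.

Lemma Im_cintegralMC D w phi :
  Im (cintegral D (fun t => w t * (phi t)%:C)) = \int[mu]_(t in D) (Im (w t) * phi t).
Proof. by rewrite /=; under eq_Rintegral do rewrite cImMC. Qed.

Definition cprim (c : R) w (t : R) : R[i] := cintegral `]c, t[ w.

Lemma cprim_ibp (c d : R) w phi : c <= d -> cintegrable `]c, d[ w -> smooth phi ->
  cintegral `]c, d[ (fun t => cprim c w t * (derive1 phi t)%:C) =
  cprim c w d * (phi d)%:C - cintegral `]c, d[ (fun t => w t * (phi t)%:C).
Proof.
move=> cd [wr wi] sphi; apply: complex_ext; rewrite ?cReD ?cImD ?cReN ?cImN.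
- by rewrite !Re_cintegralMC cReMC; exact: prim_ibp.
- by rewrite !Im_cintegralMC cImMC; exact: prim_ibp.
Qed.

Lemma cdu_bois_reymond (c d : R) w g : c < d ->
  cintegrable `]c, d[ w -> cintegrable `]c, d[ g ->
  (forall phi, test_function c d phi ->
    cintegral `]c, d[ (fun t => w t * (derive1 phi t)%:C) =
    - cintegral `]c, d[ (fun t => g t * (phi t)%:C)) ->
  exists C, {ae mu, forall t, c < t < d -> w t = C + cprim c g t}.
Proof.
move=> cd [wr wi] [gr gi] wg.
have [phi tphi|a Ha] := du_bois_reymond cd wr gr.
  by have := congr1 (@complex.Re R) (wg _ tphi); rewrite cReN !Re_cintegralMC.
have [phi tphi|b Hb] := du_bois_reymond cd wi gi.
  by have := congr1 (@complex.Im R) (wg _ tphi); rewrite cImN !Im_cintegralMC.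
exists (a +i* b); apply: ae_imp2 Ha Hb => t Ha Hb tcd.
by apply: complex_ext; rewrite ?cReD ?cImD /=; [exact: Ha|exact: Hb].
Qed.

Lemma cfundamental_lemma (c d : R) g : cintegrable `]c, d[ g ->
  (forall phi, test_function c d phi -> cintegral `]c, d[ (fun t => g t * (phi t)%:C) = 0) ->
  {ae mu, forall t, c < t < d -> g t = 0}.
Proof.
move=> [gr gi] g0.
have : {ae mu, forall t, c < t < d -> Re (g t) = 0}.
  apply: (fundamental_lemma gr) => phi /g0/(congr1 (@complex.Re R)).
  by rewrite Re_cintegralMC.
have : {ae mu, forall t, c < t < d -> Im (g t) = 0}.
  apply: (fundamental_lemma gi) => phi /g0/(congr1 (@complex.Im R)).
  by rewrite Im_cintegralMC.
by apply: ae_imp2 => t Hi Hr tcd; apply: complex_ext; rewrite /= ?Hi ?Hr.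
Qed.

End ComplexIntegral.

(** * Complex Lebesgue spaces *)

Section Lebesgue.
Local Open Scope complex_scope.
Context {R : realType}.
Implicit Types (c d : R) (phi psi : R -> R) (u v w g h : R -> R[i]) (D : set R).
Local Notation mu := (@lebesgue_measure R).
Local Notation Re := complex.Re.
Local Notation Im := complex.Im.

Definition sqmod (z : R[i]) : R := Re z ^+ 2 + Im z ^+ 2.

Lemma sqmod_ge0 z : 0 <= sqmod z. Proof. by rewrite addr_ge0// sqr_ge0. Qed.

Lemma sqmod_normc z : sqmod z = ComplexField.Normc.normc z ^+ 2.
Proof. by case: z => a b /=; rewrite sqr_sqrtr// addr_ge0// sqr_ge0. Qed.

(** Square integrability in a form stable under the operations used below: the Lebesgue
    norm of a patched modulus is traded for the integrability of a quadratic expression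
    over the interval. *)
Lemma Lp2P c d w : Lp 2%:E c d w <->
  [/\ measurable_fun `]c, d[ (fun x => Re (w x)), measurable_fun `]c, d[ (fun x => Im (w x)) &
      mu.-integrable `]c, d[ (EFin \o (fun t => sqmod (w t)))].
Proof.
have E : (\int[mu]_t `|(ComplexField.Normc.normc (patch (cst 0) `]c, d[ w t))%:E| `^ 2 =
    \int[mu]_(t in `]c, d[) `|(sqmod (w t))%:E|)%E.
  rewrite [RHS]integral_mkcond; apply: eq_integral => t _.
  rewrite !patchE; case: ifPn => _ /=.
    by rewrite powR_mulrn ?normr_ge0// real_normK ?num_real// -sqmod_normc ger0_norm ?sqmod_ge0.
  by rewrite expr0n /= addr0 sqrtr0 normr0 powR0.
split.
- move=> [mr mi wi]; split=> //; apply/integrableP; split.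
    apply/measurable_EFinP; apply: measurable_funD; exact: measurable_funX.
  by rewrite -E -poweR_Lnorm// poweR_lty.
- move=> [mr mi /integrableP[_ wi]]; split=> //.
  by rewrite unlock E poweR_lty.
Qed.

(** On a bounded interval the bound |x| <= 1 + x^2 is integrable. *)
Lemma Lp2_cintegrable c d w : Lp 2%:E c d w -> cintegrable `]c, d[ w.
Proof.
move=> /Lp2P[mr mi wi].
have bi : mu.-integrable `]c, d[ (EFin \o (fun t => 1 + sqmod (w t))).
  by apply: integrable_funD => //; exact: integrable_cst_oo.
have le1 (x y : R) : `|x| <= 1 + (x ^+ 2 + y ^+ 2).
  have : `|x| <= 1 + x ^+ 2.
    by have [_|_] := ger0P x; [have := sqr_ge0 (x - 1)|have := sqr_ge0 (x + 1)]; nra.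
  by have := sqr_ge0 y; lra.
split; apply: le_integrable bi => //; try exact/measurable_EFinP.
- move=> t _ /=; rewrite lee_fin [leRHS]ger0_norm; last by rewrite ler_wpDr// sqmod_ge0.
  exact: le1.
- move=> t _ /=; rewrite lee_fin [leRHS]ger0_norm; last by rewrite ler_wpDr// sqmod_ge0.
  by rewrite /sqmod [X in 1 + X]addrC; exact: le1.
Qed.

Lemma measurable_ReD D u v : measurable_fun D (fun x => Re (u x)) ->
    measurable_fun D (fun x => Re (v x)) ->
  measurable_fun D (fun x => Re (u x + v x)).
Proof.
move=> mu1 mv1; have -> : (fun x => Re (u x + v x)) =
    (fun x => Re (u x) + Re (v x)) by apply/funext => t; rewrite cReD.
exact: measurable_funD.
Qed.

Lemma measurable_ImD D u v : measurable_fun D (fun x => Im (u x)) ->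
    measurable_fun D (fun x => Im (v x)) ->
  measurable_fun D (fun x => Im (u x + v x)).
Proof.
move=> mu1 mv1; have -> : (fun x => Im (u x + v x)) =
    (fun x => Im (u x) + Im (v x)) by apply/funext => t; rewrite cImD.
exact: measurable_funD.
Qed.

Lemma measurable_ReM D u v : measurable_fun D (fun x => Re (u x)) ->
    measurable_fun D (fun x => Im (u x)) ->
  measurable_fun D (fun x => Re (v x)) -> measurable_fun D (fun x => Im (v x)) ->
  measurable_fun D (fun x => Re (u x * v x)).
Proof.
move=> ? ? ? ?; have -> : (fun x => Re (u x * v x)) =
    (fun x => Re (u x) * Re (v x) - Im (u x) * Im (v x)).
  by apply/funext => t; rewrite cReM.
by apply: measurable_funB; exact: measurable_funM.
Qed.

Lemma measurable_ImM D u v : measurable_fun D (fun x => Re (u x)) ->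
    measurable_fun D (fun x => Im (u x)) ->
  measurable_fun D (fun x => Re (v x)) -> measurable_fun D (fun x => Im (v x)) ->
  measurable_fun D (fun x => Im (u x * v x)).
Proof.
move=> ? ? ? ?; have -> : (fun x => Im (u x * v x)) =
    (fun x => Re (u x) * Im (v x) + Im (u x) * Re (v x)).
  by apply/funext => t; rewrite cImM.
by apply: measurable_funD; exact: measurable_funM.
Qed.

Lemma Lp2D c d u v : Lp 2%:E c d u -> Lp 2%:E c d v -> Lp 2%:E c d (fun t => u t + v t).
Proof.
move=> /Lp2P[ur ui uu] /Lp2P[vr vi vv]; apply/Lp2P; split.
- exact: measurable_ReD.
- exact: measurable_ImD.
have bi : mu.-integrable `]c, d[ (EFin \o (fun t => 2 * sqmod (u t) + 2 * sqmod (v t))).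
  by apply: integrable_funD => //; exact: integrable_funZ.
apply: le_integrable bi => //.
  apply/measurable_EFinP; apply: measurable_funD; apply: measurable_funX.
    exact: measurable_ReD.
  exact: measurable_ImD.
move=> t _ /=; rewrite lee_fin !ger0_norm; last 2 first.
- by rewrite addr_ge0// mulr_ge0// sqmod_ge0.
- exact: sqmod_ge0.
rewrite /sqmod cReD cImD.
have := sqr_ge0 (Re (u t) - Re (v t)); have := sqr_ge0 (Im (u t) - Im (v t)).
move: (Re (u t)) (Re (v t)) (Im (u t)) (Im (v t)) => a b a' b'; nra.
Qed.

Lemma Lp2Z c d (k : R[i]) u : Lp 2%:E c d u -> Lp 2%:E c d (fun t => k * u t).
Proof.
move=> /Lp2P[ur ui uu]; apply/Lp2P; split.
- by apply: (@measurable_ReM _ (fun=> k)) => //; exact: measurable_cst.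
- by apply: (@measurable_ImM _ (fun=> k)) => //; exact: measurable_cst.
have -> : (fun t => sqmod (k * u t)) = (fun t => sqmod k * sqmod (u t)).
  by apply/funext => t; rewrite /sqmod cReM cImM; ring.
exact: integrable_funZ.
Qed.

Lemma Lp2_sub c d p q w : c <= p -> q <= d -> Lp 2%:E c d w -> Lp 2%:E p q w.
Proof.
move=> cp qd /Lp2P[wr wi ww]; have S : `]p, q[ `<=` `]c, d[ by exact: subset_itvW.
apply/Lp2P; split; [exact: measurable_funS wr|exact: measurable_funS wi|].
exact: integrable_sub ww.
Qed.

Lemma Lp2_patch c d p q w : c <= p -> q <= d -> Lp 2%:E p q w ->
  Lp 2%:E c d (patch (cst 0) `]p, q[ w).
Proof.
move=> cp qd /Lp2P[wr wi ww].
have E (f : R[i] -> R) : f 0 = 0 ->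
    (fun t => f (patch (cst 0) `]p, q[ w t)) = (fun t => f (w t)) \_ `]p, q[.
  by move=> f0; apply/funext => t; rewrite !patchE; case: ifP.
have M (f : R -> R) : measurable_fun `]p, q[ f -> measurable_fun `]c, d[ (f \_ `]p, q[).
  by move=> mf; apply: measurable_funTS; apply/(measurable_restrictT _ _).1.
apply/Lp2P; split.
- by rewrite (E (@complex.Re R))//; exact: M.
- by rewrite (E (@complex.Im R))//; exact: M.
- rewrite (E sqmod); last by rewrite /sqmod /= expr0n /= addr0.
  by apply: integrableS (integrable_restrictT ww).
Qed.

Lemma LpooP c d w : Lp +oo%E c d w -> exists M : R,
  [/\ measurable_fun `]c, d[ (fun x => Re (w x)), measurable_fun `]c, d[ (fun x => Im (w x)),
    {ae mu, forall t, `]c, d[%classic t -> `|Re (w t)| <= M} &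
    {ae mu, forall t, `]c, d[%classic t -> `|Im (w t)| <= M}].
Proof.
move=> [mr mi]; rewrite unlock /Lnorm ifT; last first.
  apply: (@lt_le_trans _ _ (mu `]0, 1[%classic)); last by apply: le_measure; rewrite ?inE.
  by rewrite lebesgue_measure_itv /= lte_fin ltr01 oppr0 adde0.
move=> /(@ess_supr_bounded _ _ _ mu (fun x => `|
    ComplexField.Normc.normc (patch (cst 0) `]c, d[ w x)|)).
case=> M HM; exists M; split=> //.
- apply: ae_imp HM => t /=; rewrite patchE => H tcd; move: H; rewrite mem_set//.
  apply: le_trans; case: (w t) => a b /=; rewrite [leRHS]ger0_norm ?sqrtr_ge0//.
  by rewrite -sqrtr_sqr ler_wsqrtr// lerDl sqr_ge0.
- apply: ae_imp HM => t /=; rewrite patchE => H tcd; move: H; rewrite mem_set//.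
  apply: le_trans; case: (w t) => a b /=; rewrite [leRHS]ger0_norm ?sqrtr_ge0//.
  by rewrite -sqrtr_sqr ler_wsqrtr// lerDr sqr_ge0.
Qed.

Lemma cintegrableM_Lpoo p q c d w g : p <= c -> d <= q -> Lp +oo%E p q w ->
  cintegrable `]c, d[ g -> cintegrable `]c, d[ (fun t => w t * g t).
Proof.
move=> pc dq /LpooP[M [mr mi Mr Mi]] [gr gi].
have S : `]c, d[ `<=` `]p, q[ by exact: subset_itvW.
have B f (b : R -> R) : mu.-integrable `]c, d[ (EFin \o f) -> measurable_fun `]p, q[ b ->
    {ae mu, forall t, `]p, q[%classic t -> `|b t| <= M} ->
    mu.-integrable `]c, d[ (EFin \o (fun t => f t * b t)).
  move=> fi mb bM; apply: (@integrable_ae_bounded _ _ _ _ M) => //.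
    exact: measurable_funS mb.
  by apply: ae_imp bM => t bM /S /bM.
split.
- have -> : (fun t => Re (w t * g t)) = (fun t => Re (g t) * Re (w t) - Im (g t) * Im (w t)).
    by apply/funext => t; rewrite cReM; ring.
  by apply: integrable_funB => //; exact: B.
- have -> : (fun t => Im (w t * g t)) = (fun t => Im (g t) * Re (w t) + Re (g t) * Im (w t)).
    by apply/funext => t; rewrite cImM; ring.
  by apply: integrable_funD => //; exact: B.
Qed.

End Lebesgue.

(** * Complex limits and essential one-sided limits *)

Section ComplexLimits.
Local Open Scope complex_scope.
Context {R : realType}.
Local Notation Re := complex.Re.
Local Notation Im := complex.Im.

Lemma normr_Re_le (z : R[i]) (e : R) : `|z| < e%:C -> `|Re z| < e.
Proof. by rewrite -ltcR; apply: le_lt_trans; exact: normc_ge_Re. Qed.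

Lemma normr_Im_le (z : R[i]) (e : R) : `|z| < e%:C -> `|Im z| < e.
Proof.
rewrite -ltcR; apply: le_lt_trans; rewrite normc_def lecR.
by rewrite -sqrtr_sqr ler_wsqrtr// lerDr sqr_ge0.
Qed.

Lemma normr_le_ReIm (z : R[i]) (e : R) : `|Re z| < e / 2 -> `|Im z| < e / 2 -> `|z| < e%:C.
Proof.
move=> r i; rewrite [z]complexE.
apply: (le_lt_trans (ler_normD _ _)); rewrite normrM.
have -> : `|'i%C : R[i]| = 1 by rewrite normc_def /= expr0n expr1n add0r sqrtr1.
rewrite mul1r !normc_def /= expr0n /= !addr0 !sqrtr_sqr -rmorphD ltcR.
lra.
Qed.

Context {T : Type} {F : set_system T} {FF : Filter F}.
Implicit Type f : T -> R[i].

Lemma cvg_Re f l : f @ F --> l -> (fun t => Re (f t)) @ F --> Re l.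
Proof.
move=> /cvgrPdist_lt fl; apply/cvgrPdist_lt => e e0.
have e0' : 0 < e%:C by rewrite ltcR.
apply: filterS (fl _ e0') => t /normr_Re_le.
by rewrite cReD cReN.
Qed.

Lemma cvg_Im f l : f @ F --> l -> (fun t => Im (f t)) @ F --> Im l.
Proof.
move=> /cvgrPdist_lt fl; apply/cvgrPdist_lt => e e0.
have e0' : 0 < e%:C by rewrite ltcR.
apply: filterS (fl _ e0') => t /normr_Im_le.
by rewrite cImD cImN.
Qed.

(** Limits of complex functions are handled componentwise throughout, which reduces
    them to real limits. *)
Lemma cvg_complex f l : (fun t => Re (f t)) @ F --> Re l ->
  (fun t => Im (f t)) @ F --> Im l -> f @ F --> l.
Proof.
move=> /cvgrPdist_lt fr /cvgrPdist_lt fi; apply/cvgrPdist_lt => e e0.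
have eE : e = (Re e)%:C by rewrite RRe_real// gtr0_real.
have e20 : 0 < Re e / 2 by rewrite divr_gt0// -ltcR -eE.
apply: filterS2 (fr _ e20) (fi _ e20) => t Hr Hi; rewrite eE.
by apply: normr_le_ReIm; rewrite ?cReD ?cReN ?cImD ?cImN.
Qed.

Lemma cvg_linear (f g : T -> R[i]) (k l m : R[i]) : f @ F --> l -> g @ F --> m ->
  (fun t => f t + k * g t) @ F --> l + k * m.
Proof.
move=> fl gm.
have fr := cvg_Re fl; have fi := cvg_Im fl; have gr := cvg_Re gm; have gi := cvg_Im gm.
apply: cvg_complex; rewrite ?cReD ?cImD ?cReM ?cImM.
- under eq_fun do rewrite cReD cReM.
  apply: (cvgD fr); apply: cvgB; apply: cvgM => //; exact: cvg_cst.
- under eq_fun do rewrite cImD cImM.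
  apply: (cvgD fi); apply: cvgD; apply: cvgM => //; exact: cvg_cst.
Qed.

End ComplexLimits.
Arguments cvg_Re {R T F FF f l}.
Arguments cvg_Im {R T F FF f l}.

Section EssLimits.
Local Open Scope complex_scope.
Context {R : realType}.
Local Notation mu := (@lebesgue_measure R).

Lemma nbhs0_right_ex (P : R -> Prop) : (\forall r \near 0^'+, P r) -> exists2 r : R, 0 < r & P r.
Proof. by move=> H; near (0 : R)^'+ => r; exists r => //;
    near: r. Unshelve. all: by end_near. Qed.

Global Instance ess_at_right_filter (x : R) : ProperFilter (ess_at_right x).
Proof.
split.
  move=> /nbhs0_right_ex[r r0] H.
  have xr : x < x + r by rewrite ltrDl.
  by have [t tr /(_ tr)] := ae_ex xr H.
split.
- by rewrite /ess_at_right /=; apply: nearW => r; exact: ae_all.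
- move=> A B; rewrite /ess_at_right /=; apply: filterS2 => r; apply: ae_imp2 => t At Bt tr.
  by split; [exact: At|exact: Bt].
- move=> A B AB; rewrite /ess_at_right /=; apply: filterS => r; apply: ae_imp => t At tr.
  by apply: AB; exact: At.
Qed.

Global Instance ess_at_left_filter (x : R) : ProperFilter (ess_at_left x).
Proof.
split.
  move=> /nbhs0_right_ex[r r0] H.
  have xr : x - r < x by rewrite ltrBlDr ltrDl.
  by have [t tr /(_ tr)] := ae_ex xr H.
split.
- by rewrite /ess_at_left /=; apply: nearW => r; exact: ae_all.
- move=> A B; rewrite /ess_at_left /=; apply: filterS2 => r; apply: ae_imp2 => t At Bt tr.
  by split; [exact: At|exact: Bt].
- move=> A B AB; rewrite /ess_at_left /=; apply: filterS => r; apply: ae_imp => t At tr.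
  by apply: AB; exact: At.
Qed.

(** An almost everywhere property on an interval holds along the essential filters at
    its ends, so essential limits ignore null sets. *)
Lemma ess_at_right_ae (c d : R) (P : set R) : c < d -> {ae mu, forall t, c < t < d -> P t} ->
  ess_at_right c P.
Proof.
move=> cd HP; rewrite /ess_at_right /ess_at_left /=; near=> r;
    apply: ae_imp HP => t + /andP[ct tr]; apply.
rewrite ct (lt_le_trans tr)// -lerBrDl; near: r; apply: nbhs_right_le; rewrite subr_gt0//.
Unshelve. all: by end_near. Qed.

Lemma ess_at_left_ae (c d : R) (P : set R) : c < d -> {ae mu, forall t, c < t < d -> P t} ->
  ess_at_left d P.
Proof.
move=> cd HP; rewrite /ess_at_right /ess_at_left /=; near=> r;
    apply: ae_imp HP => t + /andP[ct tr]; apply.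
rewrite tr (le_lt_trans _ ct)// lerBrDr -lerBrDl; near: r; apply: nbhs_right_le;
    rewrite subr_gt0//.
Unshelve. all: by end_near. Qed.

Lemma ess_at_right_sub (c : R) (P : set R) : (\forall t \near c^'+, P t) -> ess_at_right c P.
Proof.
rewrite /at_right near_withinE => -[e /= e0 HP]; rewrite /ess_at_right /ess_at_left /=;
    near=> r; apply: ae_all => t /andP[ct tr].
apply: HP => //=; rewrite distrC gtr0_norm ?subr_gt0// ltrBlDl (lt_le_trans tr)// lerD2l.
by near: r; exact: nbhs_right_le.
Unshelve. all: by end_near. Qed.

Lemma ess_at_left_sub (c : R) (P : set R) : (\forall t \near c^'-, P t) -> ess_at_left c P.
Proof.
rewrite /at_left near_withinE => -[e /= e0 HP]; rewrite /ess_at_right /ess_at_left /=; near=> r;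
    apply: ae_all => t /andP[ct tr].
apply: HP => //=; rewrite gtr0_norm ?subr_gt0// ltrBlDl -ltrBlDr (le_lt_trans _ ct)// lerB//.
by near: r; exact: nbhs_right_le.
Unshelve. all: by end_near. Qed.

Lemma ess_right_cvg (c d : R) (w v : R -> R[i]) (l : R[i]) : c < d ->
  {ae mu, forall t, c < t < d -> w t = v t} -> v @ c^'+ --> l -> w @ ess_at_right c --> l.
Proof.
move=> cd wv vl A Al; have /ess_at_right_sub vA := vl A Al.
by apply: filterS2 vA (ess_at_right_ae cd wv) => t /= + ->.
Qed.

Lemma ess_left_cvg (c d : R) (w v : R -> R[i]) (l : R[i]) : c < d ->
  {ae mu, forall t, c < t < d -> w t = v t} -> v @ d^'- --> l -> w @ ess_at_left d --> l.
Proof.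
move=> cd wv vl A Al; have /ess_at_left_sub vA := vl A Al.
by apply: filterS2 vA (ess_at_left_ae cd wv) => t /= + ->.
Qed.

Lemma ess_right_eq (c d : R) (w v : R -> R[i]) (l : R[i]) : c < d ->
  {ae mu, forall t, c < t < d -> w t = v t} -> v @ ess_at_right c --> l ->
      w @ ess_at_right c --> l.
Proof.
move=> cd wv vl A Al; have vA : ess_at_right c (v @^-1` A) := vl A Al.
by apply: filterS2 vA (ess_at_right_ae cd wv) => t /= + ->.
Qed.

Lemma ess_left_eq (c d : R) (w v : R -> R[i]) (l : R[i]) : c < d ->
  {ae mu, forall t, c < t < d -> w t = v t} -> v @ ess_at_left d --> l -> w @ ess_at_left d --> l.
Proof.
move=> cd wv vl A Al; have vA : ess_at_left d (v @^-1` A) := vl A Al.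
by apply: filterS2 vA (ess_at_left_ae cd wv) => t /= + ->.
Qed.

Lemma Chausdorff : hausdorff_space R[i].
Proof. exact: norm_hausdorff. Qed.

Lemma lim_ess_at_right (x : R) (f : R -> R[i]) (l : R[i]) :
  f @ ess_at_right x --> l -> lim (f @ ess_at_right x) = l.
Proof. by move=> fl; apply: cvg_lim fl; exact: Chausdorff. Qed.

Lemma lim_ess_at_left (x : R) (f : R -> R[i]) (l : R[i]) :
  f @ ess_at_left x --> l -> lim (f @ ess_at_left x) = l.
Proof. by move=> fl; apply: cvg_lim fl; exact: Chausdorff. Qed.

End EssLimits.

(** * Sobolev functions on an interval *)

Section Sobolev.
Local Open Scope complex_scope.
Context {R : realType}.
Implicit Types (c d p q t : R) (phi psi : R -> R) (u v w g h : R -> R[i]) (D : set R).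
Local Notation mu := (@lebesgue_measure R).
Local Notation Re := complex.Re.
Local Notation Im := complex.Im.

Lemma within_complex D u : {within D, continuous (fun t => Re (u t))} ->
  {within D, continuous (fun t => Im (u t))} -> {within D, continuous u}.
Proof. by move=> ur ui t; apply: cvg_complex; [exact: ur|exact: ui]. Qed.

Lemma within_Re D u : {within D, continuous u} -> {within D, continuous (fun t => Re (u t))}.
Proof. by move=> cu t; apply: cvg_Re; exact: cu. Qed.

Lemma within_Im D u : {within D, continuous u} -> {within D, continuous (fun t => Im (u t))}.
Proof. by move=> cu t; apply: cvg_Im; exact: cu. Qed.

Lemma within_linear D u v (k : R[i]) : {within D, continuous u} -> {within D, continuous v} ->
  {within D, continuous (fun t => u t + k * v t)}.
Proof. by move=> cu cv t; apply: cvg_linear; [exact: cu|exact: cv]. Qed.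

Lemma within_cvg_right c d t u : {within `[c, d], continuous u} -> c <= t < d ->
  u @ t^'+ --> u t.
Proof.
move=> cu /andP[ct td]; have cd := le_lt_trans ct td.
have [ci cl cr] := (continuous_within_itvP u cd).1 cu.
have [ct'|ct'] := eqVneq c t; first by rewrite -ct'; exact: cl.
have {ct ct'}ct : c < t by rewrite lt_neqAle ct' ct.
by apply: cvg_at_right_filter; apply: ci; rewrite in_itv/= ct td.
Qed.

Lemma within_cvg_left c d t u : {within `[c, d], continuous u} -> c < t <= d ->
  u @ t^'- --> u t.
Proof.
move=> cu /andP[ct td]; have cd := lt_le_trans ct td.
have [ci cl cr] := (continuous_within_itvP u cd).1 cu.
have [td'|td'] := eqVneq t d; first by rewrite td'; exact: cr.
have {td td'}td : t < d by rewrite lt_neqAle td' td.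
by apply: cvg_at_left_filter; apply: ci; rewrite in_itv/= ct td.
Qed.

(** At each point of the closed interval both functions are recovered as essential
    one-sided limits, and these only depend on values almost everywhere. *)
Lemma ae_eq_continuous c d u v : c < d -> {within `[c, d], continuous u} ->
  {within `[c, d], continuous v} -> {ae mu, forall t, c < t < d -> u t = v t} ->
  forall t, c <= t <= d -> u t = v t.
Proof.
move=> cd cu cv uv t /andP[ct td].
have [td'|dt] := ltP t d.
  have H1 : u @ ess_at_right t --> v t.
    apply: (ess_right_cvg td' _ (within_cvg_right cv _)); last by rewrite ct td'.
    by apply: ae_imp uv => s uv /andP[ts sd]; apply: uv; rewrite sd (le_lt_trans ct ts).
  have H2 : u @ ess_at_right t --> u t.
    by apply: (ess_right_cvg td' _ (within_cvg_right cu _)); [exact: ae_all|rewrite ct td'].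
  exact: (cvg_unique (@Chausdorff R) H2 H1).
have {td dt} -> : t = d by apply/eqP; rewrite eq_le td dt.
have H1 : u @ ess_at_left d --> v d.
  by apply: (ess_left_cvg cd _ (within_cvg_left cv _)); [exact: uv|rewrite cd lexx].
have H2 : u @ ess_at_left d --> u d.
  by apply: (ess_left_cvg cd _ (within_cvg_left cu _)); [exact: ae_all|rewrite cd lexx].
exact: (cvg_unique (@Chausdorff R) H2 H1).
Qed.

Lemma cprim_continuous c d w : cintegrable `]c, d[ w -> {within `[c, d], continuous (cprim c w)}.
Proof. by move=> [wr wi]; apply: within_complex; exact: prim_continuous. Qed.

Lemma cprim_cintegrable c d w : cintegrable `]c, d[ w -> cintegrable `]c, d[ (cprim c w).
Proof. by move=> [wr wi]; split; exact: prim_integrable. Qed.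

Lemma cprim_left c w : cprim c w c = 0.
Proof. by rewrite /cprim /cintegral set_itvoo0 !Rintegral_set0. Qed.

Lemma within_integrable_real c d (f : R -> R) : {within `[c, d], continuous f} ->
  mu.-integrable `]c, d[ (EFin \o f).
Proof.
move=> cf; have : mu.-integrable `[c, d] (EFin \o f).
  by apply: continuous_compact_integrable => //; exact: segment_compact.
by apply: integrableS => //; exact: subset_itv_oo_cc.
Qed.

Lemma within_cintegrable c d u : {within `[c, d], continuous u} -> cintegrable `]c, d[ u.
Proof.
by move=> cu; split; apply: within_integrable_real; [exact: within_Re|exact: within_Im].
Qed.

Lemma within_Lp2 c d u : {within `[c, d], continuous u} -> Lp 2%:E c d u.
Proof.
move=> cu; apply/Lp2P; have [ur ui] := within_cintegrable cu.
split.
- by apply/measurable_EFinP; exact: measurable_int ur.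
- by apply/measurable_EFinP; exact: measurable_int ui.
apply: within_integrable_real => t.
have Hr := @within_Re _ _ cu t; have Hi := @within_Im _ _ cu t.
exact: (cvgD (cvgM Hr Hr) (cvgM Hi Hi)).
Qed.

Lemma cintegrable_sub c d p q w : c <= p -> q <= d -> cintegrable `]c, d[ w ->
    cintegrable `]p, q[ w.
Proof. by move=> cp qd; apply: cintegrableS => //; exact: subset_itvW. Qed.

Lemma cintegral_test_sub c d p q w phi : c <= p -> q <= d -> test_function p q phi ->
  cintegral `]c, d[ (fun t => w t * (phi t)%:C) = cintegral `]p, q[ (fun t => w t * (phi t)%:C).
Proof.
move=> cp qd tphi; apply: cintegral_support; first exact: subset_itvW.
move=> t _ /= /negP; rewrite in_itv/= => tpq.
by rewrite (test_out tphi tpq) rmorph0 mulr0.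
Qed.

Lemma is_wderiv_sub c d p q u w : c <= p -> q <= d -> is_wderiv c d u w -> is_wderiv p q u w.
Proof.
move=> cp qd [wL uw]; split; first exact: Lp2_sub wL.
move=> phi tphi; have := uw _ (test_widen cp qd tphi).
rewrite /deriv_distr /regular_distr !(cintegral_test_sub _ cp qd)//.
exact: test_derive1.
Qed.

Lemma H1_sub c d p q u : c <= p -> q <= d -> H1 c d u -> H1 p q u.
Proof.
move=> cp qd [cu Lu [w uw]]; split.
- apply: continuous_subspaceW cu => t; rewrite /= !in_itv/= => /andP[pt tq].
  by rewrite (le_trans cp)//= (le_trans tq).
- exact: Lp2_sub Lu.
- by exists w; exact: is_wderiv_sub uw.
Qed.

Lemma wderivP c d u : H1 c d u -> is_wderiv c d u (wderiv c d u).
Proof. by case=> _ _ Hw; rewrite /wderiv; case: xgetP => [w _ //|/(_ _)];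
    case: Hw => w uw /(_ w). Qed.

Lemma is_wderiv_unique c d u v w : is_wderiv c d u v -> is_wderiv c d u w ->
  {ae mu, forall t, c < t < d -> v t = w t}.
Proof.
move=> [vL uv] [wL uw].
have vi := Lp2_cintegrable vL; have wi := Lp2_cintegrable wL.
have H : {ae mu, forall t, c < t < d -> v t + -1 * w t = 0}.
  apply: cfundamental_lemma => [|phi tphi].
    by apply: cintegrableD => //; exact: cintegrableZ.
  have cphi := test_continuous tphi.
  have E : forall t, (v t + -1 * w t) * (phi t)%:C = v t * (phi t)%:C + -1 * (w t * (phi t)%:C).
    by move=> t; ring.
  under [LHS]eq_cintegral do rewrite E.
  rewrite cintegralD//; [|exact: cintegrableMC|by apply: cintegrableZ => //;
      exact: cintegrableMC].
  rewrite cintegralZ//; last exact: cintegrableMC.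
  by have := uv _ tphi; rewrite (uw _ tphi) /regular_distr => <-; ring.
apply: ae_imp H => t H /H /eqP; rewrite mulN1r subr_eq0 => /eqP //.
Qed.

(** Du Bois-Reymond gives the formula almost everywhere up to a constant; continuity on
    the closed interval upgrades it to all points and identifies the constant as u(c). *)
Lemma H1_prim c d u w : c < d -> H1 c d u -> is_wderiv c d u w ->
  forall t, c <= t <= d -> u t = u c + cprim c w t.
Proof.
move=> cd [cu Lu _] [wL uw].
have ui := Lp2_cintegrable Lu; have wi := Lp2_cintegrable wL.
have [phi tphi|C HC] := cdu_bois_reymond cd ui wi.
  by have := uw _ tphi; rewrite /deriv_distr /regular_distr => <-; rewrite opprK.
have H := @ae_eq_continuous c d u (fun t => C + 1 * cprim c w t) cd cu.
have {}H : forall t, c <= t <= d -> u t = C + 1 * cprim c w t.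
  apply: H.
    apply: (@within_linear _ (fun=> C)); last exact: cprim_continuous.
    by apply: continuous_subspaceT; exact: cst_continuous.
  by apply: ae_imp HC => t HC /HC ->; rewrite mul1r.
have uc : u c = C by rewrite H ?lexx ?ltW// cprim_left mulr0 addr0.
by move=> t tcd; rewrite uc H// mul1r.
Qed.

(** The converse of the previous lemma. Together they replace weak derivatives by
    primitives, and gluing pieces becomes a computation with integrals. *)
Lemma prim_H1 c d u w : c < d -> Lp 2%:E c d w ->
  (forall t, c <= t <= d -> u t = u c + cprim c w t) -> H1 c d u /\ is_wderiv c d u w.
Proof.
move=> cd wL uE; have wi := Lp2_cintegrable wL.
have cu : {within `[c, d], continuous u}.
  apply: (@subspace_eq_continuous _ _ _ (fun t => u c + 1 * cprim c w t)).
    by move=> t; rewrite inE/= in_itv/= => tcd; rewrite /from_subspace/= mul1r -uE.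
  apply: (@within_linear _ (fun=> u c)); last exact: cprim_continuous.
  by apply: continuous_subspaceT; exact: cst_continuous.
have uw : is_wderiv c d u w.
  split=> // phi tphi; rewrite /deriv_distr /regular_distr.
  have cphi' := test_continuous (test_derive1 tphi).
  have sphi := test_smooth tphi.
  transitivity (- cintegral `]c, d[ (fun t => u c * (derive1 phi t)%:C + cprim c w t * (derive1
      phi t)%:C)).
    congr (- _); apply: eq_cintegral => t; rewrite inE/= in_itv/= => /andP[ct td].
    by rewrite uE ?mulrDl// !ltW.
  rewrite cintegralD//; last 2 first.
  - by apply: cintegrableMC => //; apply: within_cintegrable; apply: continuous_subspaceT;
      exact: cst_continuous.
  - by apply: cintegrableMC => //; exact: cprim_cintegrable.
  rewrite cprim_ibp ?ltW// (test_out tphi) ?ltxx ?andbF// rmorph0 mulr0 sub0r.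
  rewrite cintegralZ//; last first.
    split; first exact: continuous_integrable_oo.
    exact: integrable0.
  have -> : cintegral `]c, d[ (fun t => (derive1 phi t)%:C) = 0.
    apply: complex_ext; rewrite /=; last by rewrite /Rintegral integral0.
    rewrite Rintegral_derive1 ?ltW// !(test_out tphi) ?subrr ?ltxx ?andbF//.
  by rewrite mulr0 add0r opprK.
by split=> //; split=> //; [exact: within_Lp2|exists w].
Qed.

End Sobolev.

(** * Fluxes of weak solutions *)

Section WeakSolutions.
Local Open Scope complex_scope.
Context {R : realType} (P : helmholtz R).
Context (a_Loo : Lp +oo%E 0 1 (aC P)) (k_Loo : Lp +oo%E 0 1 (coef_kappa P)).
Implicit Types (c d p q t y : R) (phi psi : R -> R) (u v w g h : R -> R[i]) (D : set R).
Local Notation mu := (@lebesgue_measure R).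
Local Notation Re := complex.Re.
Local Notation Im := complex.Im.

(** The term of order zero of the equation. *)
Definition reaction u t : R[i] := coef_kappa P t ^+ 2 * u t.

Lemma flux_cintegrable c d u : 0 <= c -> d <= 1 -> H1 c d u -> cintegrable `]c, d[ (flux P c d u).
Proof.
move=> c0 d1 /wderivP[wL _]; apply: (cintegrableM_Lpoo c0 d1 a_Loo).
exact: Lp2_cintegrable.
Qed.

Lemma reaction_cintegrable c d u : 0 <= c -> d <= 1 -> H1 c d u ->
    cintegrable `]c, d[ (reaction u).
Proof.
move=> c0 d1 [cu _ _]; rewrite /reaction.
have -> : (fun t => coef_kappa P t ^+ 2 * u t) =
    (fun t => coef_kappa P t * (coef_kappa P t * u t)).
  by apply/funext => t; rewrite expr2 mulrA.
do 2 apply: (cintegrableM_Lpoo c0 d1 k_Loo).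
exact: within_cintegrable.
Qed.

Lemma flux_sub c d p q u : c <= p -> q <= d -> H1 c d u ->
  {ae mu, forall t, p < t < q -> flux P p q u t = flux P c d u t}.
Proof.
move=> cp qd Hu.
have H := is_wderiv_unique (wderivP (H1_sub cp qd Hu)) (is_wderiv_sub cp qd (wderivP Hu)).
by apply: ae_imp H => t H /H; rewrite /flux => ->.
Qed.

Lemma cintegral_real D (f : R -> R) : cintegral D (fun t => (f t)%:C) =
    (\int[mu]_(t in D) f t)%:C.
Proof. by apply: complex_ext => //=; rewrite /Rintegral integral0. Qed.

Lemma cst_cintegrable c d (k : R[i]) : cintegrable `]c, d[ (fun=> k).
Proof. by apply: within_cintegrable; apply: continuous_subspaceT; exact: cst_continuous. Qed.

Lemma heaviside_cintegrable c d y : cintegrable `]c, d[ (fun t => ((y < t)%R%:R : R)%:C).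
Proof.
split; last exact: integrable0.
apply: (@le_integrable _ _ _ _ _ _ _ (EFin \o cst 1)) => //.
- apply/measurable_EFinP;
    apply: (@measurableT_comp _ _ _ _ _ _ (fun b : bool => (b : nat)%:R : R)) => //.
  exact: measurable_fun_ltr.
- by move=> t _ /=; rewrite lee_fin normr1 ger0_norm// lern1 leq_b1.
- exact: integrable_cst_oo.
Qed.

(** The primitive of a Dirac mass at y is the Heaviside function of the set y < t. *)
Lemma heaviside_ibp c d y phi : c < y < d -> smooth phi ->
  cintegral `]c, d[ (fun t => ((y < t)%R%:R : R)%:C * (derive1 phi t)%:C) =
      (phi d)%:C - (phi y)%:C.
Proof.
move=> /andP[cy yd] sphi.
rewrite (@cintegral_support _ `]y, d[); last 2 first.
- by apply: subset_itvW => //; exact: ltW.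
- move=> t; rewrite /= !in_itv/= => /andP[_ ->]; rewrite andbT => /negP/negbTE ->.
  by rewrite mul0r.
transitivity (phi d - phi y)%:C; last by rewrite rmorphB.
rewrite -(Rintegral_derive1 sphi (ltW yd)) -cintegral_real.
by apply: eq_cintegral => t; rewrite inE/= in_itv/= => /andP[-> _]; rewrite mul1r.
Qed.

(** The structure of the flux of a solution of L u = s delta_y + g. Subtracting s times
    the Heaviside function at y from the flux leaves a function with integrable weak
    derivative g - kappa^2 u, hence by du Bois-Reymond an absolutely continuous one.
    This gives the two one-sided limits, and integration by parts against a function
    that need not vanish at c and d produces them as boundary terms. *)
Lemma weak_flux c d y (s : R[i]) g u : 0 <= c -> d <= 1 -> c < y < d ->
  H1 c d u -> cintegrable `]c, d[ g ->
  (forall phi, test_function c d phi ->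
     Lop P c d u phi = s * (phi y)%:C + regular_distr c d g phi) ->
  exists L : R[i] * R[i],
  [/\ flux P c d u @ ess_at_right c --> L.1, flux P c d u @ ess_at_left d --> L.2 &
    forall phi, smooth phi ->
      - cintegral `]c, d[ (fun t => flux P c d u t * (derive1 phi t)%:C) +
        cintegral `]c, d[ (fun t => reaction u t * (phi t)%:C) =
      s * (phi y)%:C + regular_distr c d g phi + L.1 * (phi c)%:C - L.2 * (phi d)%:C].
Proof.
move=> c0 d1 cyd Hu gi Lu; have /andP[cy yd] := cyd; have cd := lt_trans cy yd.
have Fi := flux_cintegrable c0 d1 Hu; have ki := reaction_cintegrable c0 d1 Hu.
pose H t : R[i] := ((y < t)%R%:R : R)%:C.
have Hi : cintegrable `]c, d[ H by exact: heaviside_cintegrable.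
pose h t := g t + -1 * reaction u t.
have hi : cintegrable `]c, d[ h by apply: cintegrableD => //; exact: cintegrableZ.
have hE phi : continuous phi -> cintegral `]c, d[ (fun t => h t * (phi t)%:C) =
    regular_distr c d g phi - cintegral `]c, d[ (fun t => reaction u t * (phi t)%:C).
  move=> cphi.
  under eq_cintegral do rewrite /h mulrDl -mulrA.
  rewrite cintegralD//; [|exact: cintegrableMC|by apply: cintegrableZ => //;
      exact: cintegrableMC].
  by rewrite cintegralZ ?mulN1r//; exact: cintegrableMC.
have [|phi tphi|C HC] := @cdu_bois_reymond _ c d (fun t => flux P c d u t + (- s) * H t) h cd _
    hi.
- by apply: cintegrableD => //; exact: cintegrableZ.
- have cphi' := test_continuous (test_derive1 tphi); have cphi := test_continuous tphi.
  rewrite hE//; have E := Lu _ tphi.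
  under eq_cintegral do rewrite mulrDl -[- s * _ * _]mulrA.
  rewrite cintegralD//; [|exact: cintegrableMC|by apply: cintegrableZ => //;
      exact: cintegrableMC].
  rewrite cintegralZ//; last exact: cintegrableMC.
  rewrite heaviside_ibp//; last exact: test_smooth tphi.
  rewrite (test_out tphi) ?ltxx ?andbF// rmorph0.
  have alg (X Y S G z : R[i]) : - X + Y = S * z + G -> X + - S * (0 - z) = - (G - Y).
    move=> XY; have -> : G = - X + Y - S * z by rewrite XY; ring.
    ring.
  exact: alg E.
pose F t := C + s * H t + cprim c h t.
have FE : {ae mu, forall t, c < t < d -> flux P c d u t = F t}.
  apply: ae_imp HC => t HC /HC HE; rewrite /F -addrA [s * _ + _]addrC addrA -HE; ring.
have cw k : {within `[c, d], continuous (fun t => k + 1 * cprim c h t)}.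
  apply: (@within_linear _ _ (fun=> k)); last exact: cprim_continuous.
  by apply: continuous_subspaceT; exact: cst_continuous.
exists (C, C + s + cprim c h d); split=> /=.
- have := @within_cvg_right _ c d c _ (cw C); rewrite lexx cd cprim_left mulr0 addr0 => /(_ isT).
  apply: (@ess_right_cvg _ c y) => //.
  apply: ae_imp FE => t FE /andP[ct ty]; rewrite FE ?ct ?(lt_trans ty)// /F /H.
  by rewrite ltNge (ltW ty) /= mulr0 addr0 mul1r.
- have := @within_cvg_left _ c d d _ (cw (C + s)); rewrite lexx cd mul1r => /(_ isT).
  apply: (@ess_left_cvg _ y d) => //.
  apply: ae_imp FE => t FE /andP[yt td]; rewrite FE ?td ?(lt_trans cy)// /F /H.
  by rewrite yt mulr1 mul1r.
move=> phi sphi.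
have cphi' := smooth_continuous (smooth_derive1 sphi); have cphi := smooth_continuous sphi.
have FI : cintegral `]c, d[ (fun t => flux P c d u t * (derive1 phi t)%:C) =
  C * ((phi d)%:C - (phi c)%:C) + s * ((phi d)%:C - (phi y)%:C) +
  (cprim c h d * (phi d)%:C - cintegral `]c, d[ (fun t => h t * (phi t)%:C)).
  transitivity (cintegral `]c, d[ (fun t => F t * (derive1 phi t)%:C)).
    apply: ae_eq_cintegral => //.
    - exact: cintegrableMC.
    - apply: cintegrableMC => //; apply: cintegrableD => //; last exact: cprim_cintegrable.
      by apply: cintegrableD => //; [exact: cst_cintegrable|exact: cintegrableZ].
    by apply: ae_imp FE => t FE; rewrite /= in_itv/= => /FE ->.
  under eq_cintegral do rewrite /F mulrDl mulrDl -[s * _ * _]mulrA.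
  have I1 : cintegrable `]c, d[ (fun t => C * (derive1 phi t)%:C).
    by apply: cintegrableMC => //; exact: cst_cintegrable.
  have I2 : cintegrable `]c, d[ (fun t => H t * (derive1 phi t)%:C) by exact: cintegrableMC.
  have I3 : cintegrable `]c, d[ (fun t => s * (H t * (derive1 phi t)%:C)) by exact: cintegrableZ.
  have I4 : cintegrable `]c, d[ (fun t => cprim c h t * (derive1 phi t)%:C).
    by apply: cintegrableMC => //; exact: cprim_cintegrable.
  have I5 : cintegrable `]c, d[ (fun t => (derive1 phi t)%:C).
    by split; [exact: continuous_integrable_oo|exact: integrable0].
  rewrite cintegralD//; last exact: cintegrableD.
  rewrite cintegralD// !cintegralZ// cprim_ibp ?ltW// heaviside_ibp// cintegral_real.
  by rewrite Rintegral_derive1 ?ltW// rmorphB.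
rewrite FI hE//; ring.
Qed.

End WeakSolutions.

(** * Linear structure and restriction of weak solutions *)

Section Linearity.
Local Open Scope complex_scope.
Context {R : realType} (P : helmholtz R).
Context (a_Loo : Lp +oo%E 0 1 (aC P)) (k_Loo : Lp +oo%E 0 1 (coef_kappa P)).
Implicit Types (c d p q t y : R) (k : R[i]) (phi psi : R -> R) (u v w g h : R ->
    R[i]) (D : set R).
Local Notation mu := (@lebesgue_measure R).

Lemma regular_distr_linear c d u v k phi : continuous phi ->
  cintegrable `]c, d[ u -> cintegrable `]c, d[ v ->
  regular_distr c d (fun t => u t + k * v t) phi =
      regular_distr c d u phi + k * regular_distr c d v phi.
Proof.
move=> cphi ui vi; rewrite /regular_distr.
under eq_cintegral do rewrite mulrDl -[k * _ * _]mulrA.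
have vphi := cintegrableMC cphi vi.
rewrite cintegralD//; [|exact: cintegrableMC|exact: cintegrableZ].
by rewrite cintegralZ.
Qed.

Lemma is_wderiv_linear c d u v w h k : cintegrable `]c, d[ u -> cintegrable `]c, d[ v ->
  is_wderiv c d u w -> is_wderiv c d v h ->
  is_wderiv c d (fun t => u t + k * v t) (fun t => w t + k * h t).
Proof.
move=> ui vi [wL uw] [hL vh]; split; first by apply: Lp2D => //; exact: Lp2Z.
have wi := Lp2_cintegrable wL; have hi := Lp2_cintegrable hL.
move=> phi tphi; have cphi := test_continuous tphi;
    have cphi' := test_continuous (test_derive1 tphi).
rewrite /deriv_distr regular_distr_linear// opprD -mulrN.
by have := uw _ tphi; have := vh _ tphi; rewrite /deriv_distr => -> ->;
    rewrite regular_distr_linear.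
Qed.

Lemma H1_linear c d u v k : H1 c d u -> H1 c d v -> H1 c d (fun t => u t + k * v t).
Proof.
move=> Hu Hv; have [cu Lu _] := Hu; have [cv Lv _] := Hv.
have cuv := @within_linear R `[c, d]%classic u v k cu cv.
split; [exact: cuv| |].
  by apply: Lp2D => //; exact: Lp2Z.
by eexists; apply: is_wderiv_linear (wderivP Hu) (wderivP Hv); exact: within_cintegrable.
Qed.

Lemma flux_linear c d u v k : H1 c d u -> H1 c d v ->
  {ae mu, forall t, c < t < d -> flux P c d (fun t => u t + k * v t) t =
    flux P c d u t + k * flux P c d v t}.
Proof.
move=> Hu Hv; have [cu _ _] := Hu; have [cv _ _] := Hv.
have W := is_wderiv_linear k (within_cintegrable cu) (within_cintegrable cv) (wderivP Hu)
    (wderivP Hv).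
have := is_wderiv_unique (wderivP (H1_linear k Hu Hv)) W.
by apply: ae_imp => t H /H; rewrite /flux => ->; ring.
Qed.

Lemma Lop_fluxE c d u phi : Lop P c d u phi =
  - regular_distr c d (flux P c d u) (derive1 phi) + regular_distr c d (reaction P u) phi.
Proof. by []. Qed.

(** Weak derivatives are only defined up to null sets, so distributions built on them
    are compared through this lemma. *)
Lemma regular_distr_ae c d u v phi : continuous phi ->
  cintegrable `]c, d[ u -> cintegrable `]c, d[ v ->
  {ae mu, forall t, c < t < d -> u t = v t} -> regular_distr c d u phi = regular_distr c d v phi.
Proof.
move=> cphi ui vi uv; apply: ae_eq_cintegral => //; [exact: cintegrableMC|exact: cintegrableMC|].
by apply: ae_imp uv => t uv; rewrite /= in_itv/= => /uv ->.
Qed.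

Lemma Lop_linear c d u v k phi : 0 <= c -> d <= 1 -> H1 c d u -> H1 c d v ->
  test_function c d phi ->
  Lop P c d (fun t => u t + k * v t) phi = Lop P c d u phi + k * Lop P c d v phi.
Proof.
move=> c0 d1 Hu Hv tphi; rewrite !Lop_fluxE.
have cphi := test_continuous tphi; have cphi' := test_continuous (test_derive1 tphi).
have Fu := flux_cintegrable a_Loo c0 d1 Hu; have Fv := flux_cintegrable a_Loo c0 d1 Hv.
have Ku := reaction_cintegrable k_Loo c0 d1 Hu; have Kv := reaction_cintegrable k_Loo c0 d1 Hv.
rewrite (regular_distr_ae cphi' _ _ (flux_linear k Hu Hv)); last 2 first.
- exact: (flux_cintegrable a_Loo c0 d1 (H1_linear k Hu Hv)).
- by apply: cintegrableD => //; exact: cintegrableZ.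
have -> : reaction P (fun t => u t + k * v t) = fun t => reaction P u t + k * reaction P v t.
  by apply/funext => t; rewrite /reaction; ring.
rewrite (regular_distr_linear k cphi' Fu Fv) (regular_distr_linear k cphi Ku Kv).
move: (regular_distr _ _ _ _) (regular_distr _ _ _ _) (regular_distr _ _ _ _) (regular_distr _ _
    _ _).
by move=> X1 X2 X3 X4; ring.
Qed.

Let robin_linear0 (a x y X1 X2 X3 k : R[i]) :
  a * (x + k * y) + 0 * X1 = a * x + 0 * X2 + k * (a * y + 0 * X3).
Proof. by ring. Qed.

Let robin_eq0 (a X1 X2 : R[i]) : a + 0 * X1 = a + 0 * X2.
Proof. by ring. Qed.

Let robin_linear (a b x y X A B D k LA LB : R[i]) : X = LA + k * LB -> A = LA -> B = LB ->
  a * (x + k * y) + b * (X / D) = a * x + b * (A / D) + k * (a * y + b * (B / D)).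
Proof. by move=> -> -> ->; ring. Qed.

Lemma robin_eq (a b X Y D : R[i]) : X = Y -> a + b * (X / D) = a + b * (Y / D).
Proof. by move=> ->. Qed.

Let robin_zero (a b x X D : R[i]) : x = 0 -> X = 0 -> a * x + b * (X / D) = 0.
Proof. by move=> -> ->; ring. Qed.

(** When the coefficient of the derivative vanishes no limit is assumed to exist, but
    then the total limit operator is multiplied by 0. *)
Lemma left_bc_linear c d u v k (g1 g2 : R[i]) : c < d -> H1 c d u -> H1 c d v ->
  left_bc P c d g1 u -> left_bc P c d g2 v ->
  left_bc P c d (g1 + k * g2) (fun t => u t + k * v t).
Proof.
move=> cd Hu Hv; rewrite /left_bc; case: ifPn => [/eqP c0|_]; last by move=> -> ->;
    rewrite mulr0 addr0.
subst c; move=> [cu <-] [cv <-].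
have [l0|l0] := eqVneq (lam1L P) 0.
  split; [move=> F; discriminate F|rewrite /B0 l0; exact: robin_linear0].
have /cvg_ex[Lu HLu] := cu l0; have /cvg_ex[Lv HLv] := cv l0.
have H : flux P 0 d (fun t => u t + k * v t) @ ess_at_right 0 --> Lu + k * Lv.
  exact: (ess_right_eq cd (flux_linear k Hu Hv) (cvg_linear HLu HLv)).
split; first by move=> _; apply/cvg_ex; exists (Lu + k * Lv); exact: H.
have E := lim_ess_at_right H.
have Eu := lim_ess_at_right HLu; have Ev := lim_ess_at_right HLv.
rewrite /B0; exact: (robin_linear _ _ _ _ _ E Eu Ev).
Qed.

Lemma right_bc_linear c d u v k (g1 g2 : R[i]) : c < d -> H1 c d u -> H1 c d v ->
  right_bc P c d g1 u -> right_bc P c d g2 v ->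
  right_bc P c d (g1 + k * g2) (fun t => u t + k * v t).
Proof.
move=> cd Hu Hv; rewrite /right_bc; case: ifPn => [/eqP c0|_]; last by move=> -> ->;
    rewrite mulr0 addr0.
subst d; move=> [cu <-] [cv <-].
have [l0|l0] := eqVneq (lam1R P) 0.
  split; [move=> F; discriminate F|rewrite /B1 l0; exact: robin_linear0].
have /cvg_ex[Lu HLu] := cu l0; have /cvg_ex[Lv HLv] := cv l0.
have H : flux P c 1 (fun t => u t + k * v t) @ ess_at_left 1 --> Lu + k * Lv.
  exact: (ess_left_eq cd (flux_linear k Hu Hv) (cvg_linear HLu HLv)).
split; first by move=> _; apply/cvg_ex; exists (Lu + k * Lv); exact: H.
have E := lim_ess_at_left H.
have Eu := lim_ess_at_left HLu; have Ev := lim_ess_at_left HLv.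
rewrite /B0 /B1; exact: (robin_linear _ _ _ _ _ E Eu Ev).
Qed.

Lemma weak_linear c d (T1 T2 : @Defs.distribution R) (gl1 gl2 gr1 gr2 k : R[i]) u v :
  0 <= c -> c < d -> d <= 1 ->
  weak_solution P c d T1 gl1 gr1 u -> weak_solution P c d T2 gl2 gr2 v ->
  weak_solution P c d (fun phi => T1 phi + k * T2 phi) (gl1 + k * gl2) (gr1 + k * gr2)
    (fun t => u t + k * v t).
Proof.
move=> c0 cd d1 [Hu Lu lu ru] [Hv Lv lv rv]; split.
- exact: H1_linear.
- by move=> phi tphi; rewrite Lop_linear// Lu// Lv.
- exact: left_bc_linear.
- exact: right_bc_linear.
Qed.

(** A function that vanishes on the closed interval may be arbitrary outside, so it
    need not be the zero function. *)
Lemma zero_H1 c d u : 0 <= c -> c < d -> d <= 1 -> (forall t, c <= t <= d -> u t = 0) ->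
  [/\ H1 c d u, {ae mu, forall t, c < t < d -> flux P c d u t = 0} &
    forall phi, test_function c d phi -> Lop P c d u phi = 0].
Proof.
move=> c0 cd d1 u0.
have L0 : Lp 2%:E c d (cst 0 : R -> R[i]).
  by apply: within_Lp2; apply: continuous_subspaceT; exact: cst_continuous.
have [Hu Wu] : H1 c d u /\ is_wderiv c d u (cst 0).
  apply: prim_H1 => // t tcd; rewrite (u0 t tcd) (u0 c) ?lexx ?(ltW cd)//.
  by rewrite /cprim cintegral0 addr0.
have F0 : {ae mu, forall t, c < t < d -> flux P c d u t = 0}.
  by apply: ae_imp (is_wderiv_unique (wderivP Hu) Wu) => t H /H; rewrite /flux => ->;
      rewrite mulr0.
have R0 phi : regular_distr c d (cst 0) phi = 0.
  rewrite /regular_distr; under eq_cintegral do rewrite /= mul0r.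
  exact: cintegral0.
split; [exact: Hu|exact: F0|move=> phi tphi; rewrite Lop_fluxE].
have cphi' := test_continuous (test_derive1 tphi).
rewrite (regular_distr_ae cphi' (flux_cintegrable a_Loo c0 d1 Hu) (cintegrable0 _) F0) R0.
rewrite oppr0 add0r -[RHS](R0 phi); apply: eq_cintegral => t;
    rewrite inE/= in_itv/= => /andP[ct td].
by rewrite /reaction u0 ?mulr0// !ltW.
Qed.

Lemma ess_right_zero c d w : c < d -> {ae mu, forall t, c < t < d -> w t = 0} ->
  w @ ess_at_right c --> (0 : R[i]).
Proof. by move=> cd w0; apply: (ess_right_eq cd w0); exact: cvg_cst. Qed.

Lemma ess_left_zero c d w : c < d -> {ae mu, forall t, c < t < d -> w t = 0} ->
  w @ ess_at_left d --> (0 : R[i]).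
Proof. by move=> cd w0; apply: (ess_left_eq cd w0); exact: cvg_cst. Qed.

(** The flux is taken on (c, q) but only its values near c matter. *)
Lemma zero_left_bc c d q u : c < d -> u c = 0 ->
  {ae mu, forall t, c < t < d -> flux P c q u t = 0} -> left_bc P c q 0 u.
Proof.
move=> cd uc F0; rewrite /left_bc; case: ifPn => [/eqP c0|_]; last exact: uc.
subst c; have H := ess_right_zero cd F0; split.
  by move=> _; apply/cvg_ex; exists 0; exact: H.
rewrite /B0 /B1; exact: (robin_zero _ _ _ uc (lim_ess_at_right H)).
Qed.

Lemma zero_right_bc c d q u : c < d -> u d = 0 ->
  {ae mu, forall t, c < t < d -> flux P q d u t = 0} -> right_bc P q d 0 u.
Proof.
move=> cd ud F0; rewrite /right_bc; case: ifPn => [/eqP d1|_]; last exact: ud.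
subst d; have H := ess_left_zero cd F0; split.
  by move=> _; apply/cvg_ex; exists 0; exact: H.
rewrite /B0 /B1; exact: (robin_zero _ _ _ ud (lim_ess_at_left H)).
Qed.

Lemma weak_zero c d : 0 <= c -> c < d -> d <= 1 ->
  weak_solution P c d (fun=> 0) 0 0 (fun=> 0).
Proof.
move=> c0 cd d1; have [Hu F0 L0] := @zero_H1 c d (fun=> 0) c0 cd d1 (fun _ _ => erefl).
by split; [exact: Hu|exact: L0|exact: (zero_left_bc cd erefl F0)|
    exact: (zero_right_bc cd erefl F0)].
Qed.

(** The operator is local, although the choice of the weak derivative depends on the
    interval. *)
Lemma Lop_sub c d p q u phi : 0 <= c -> c <= p -> q <= d -> d <= 1 -> H1 c d u ->
  test_function p q phi -> Lop P p q u phi = Lop P c d u phi.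
Proof.
move=> c0 cp qd d1 Hu tphi; have tphi' := test_derive1 tphi.
have cphi' := test_continuous tphi'; have Hpq := H1_sub cp qd Hu.
have E (w : R -> R[i]) psi : test_function p q psi ->
    regular_distr c d w psi = regular_distr p q w psi.
  exact: cintegral_test_sub.
rewrite !Lop_fluxE (E _ _ tphi) (E _ _ tphi').
have Fpq := flux_cintegrable a_Loo (le_trans c0 cp) (le_trans qd d1) Hpq.
have Fcd := cintegrable_sub cp qd (flux_cintegrable a_Loo c0 d1 Hu).
by rewrite (regular_distr_ae cphi' Fpq Fcd (flux_sub P cp qd Hu)).
Qed.

Lemma right_bc_sub c d y gr u : c <= y -> y < d -> H1 c d u ->
  right_bc P c d gr u -> right_bc P y d gr u.
Proof.
move=> cy yd Hu; rewrite /right_bc; have [d1|_] := eqVneq d 1; last by move=> H; exact: H.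
subst d; have F := flux_sub P cy (lexx 1) Hu.
have F' : {ae mu, forall t, y < t < 1 -> flux P c 1 u t = flux P y 1 u t}.
  by apply: ae_imp F => t H /H ->.
have E : lam1R P != 0 -> cvg (flux P c 1 u @ ess_at_left 1) ->
    cvg (flux P y 1 u @ ess_at_left 1) /\
    lim (flux P y 1 u @ ess_at_left 1) = lim (flux P c 1 u @ ess_at_left 1).
  move=> _ /cvg_ex[L HL]; have H := ess_left_eq yd F HL.
  split; first by apply/cvg_ex; exists L; exact: H.
  exact: (etrans (lim_ess_at_left H) (esym (lim_ess_at_left HL))).
move=> [cu <-]; have [l0|l0] := eqVneq (lam1R P) 0.
  split; [move=> ff; discriminate ff|rewrite /B1 l0; exact: robin_eq0].
by have [e1 e2] := E l0 (cu l0); split; [move=> _; exact: e1|rewrite /B1; exact: robin_eq e2].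
Qed.

End Linearity.

(** * Extension by zero *)

Section Extension.
Local Open Scope complex_scope.
Context {R : realType} (P : helmholtz R).
Context (a_Loo : Lp +oo%E 0 1 (aC P)) (k_Loo : Lp +oo%E 0 1 (coef_kappa P)).
Implicit Types (phi psi : R -> R) (v w g h : R -> R[i]).
Local Notation mu := (@lebesgue_measure R).

Context (c d : R) (c0 : 0 <= c) (cd : c < d) (d1 : d <= 1).
Context (u : R -> R[i]) (Hu : H1 c d u) (uc : c != 0 -> u c = 0) (ud : d != 1 -> u d = 0).

Local Notation w := (wderiv c d u).
Local Notation ext := (patch (cst 0) `[c, d] u).
Local Notation wext := (patch (cst 0) `]c, d[ w).

Lemma ext_in t : c <= t <= d -> ext t = u t.
Proof. by move=> tcd; rewrite patchE mem_setE in_itv/= tcd. Qed.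

Lemma ext_out t : ~~ (c <= t <= d) -> ext t = 0.
Proof. by move=> /negbTE tcd; rewrite patchE mem_setE in_itv/= tcd. Qed.

Lemma ext_at0 : ext 0 = u c.
Proof.
have [cz|cn0] := eqVneq c 0.
  by rewrite ext_in -?cz// lexx ltW.
by rewrite uc// ext_out// negb_and -!ltNge lt_neqAle eq_sym cn0 c0.
Qed.

Lemma ext_out_oo t : 0 < t < 1 -> ~~ (c < t < d) -> ext t = 0.
Proof.
move=> /andP[t0 t1]; rewrite negb_and -!leNgt => /orP[tc|dt].
  have [tcd|] := boolP (c <= t <= d); last exact: ext_out.
  have tE : t = c by apply/eqP; rewrite eq_le tc; case/andP: tcd.
  by rewrite ext_in// tE uc// -tE gt_eqF.
have [tcd|] := boolP (c <= t <= d); last exact: ext_out.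
have tE : t = d by apply/eqP; rewrite eq_le dt andbT; case/andP: tcd.
by rewrite ext_in// tE ud// -tE lt_eqF.
Qed.

(** With the next lemma, the primitive of the extended derivative: it is constant on
    either side of [c, d]. *)
Lemma cprim_ext t : c <= t -> cprim 0 wext t = cprim c w (Num.min t d).
Proof.
move=> ct; rewrite /cprim (@cintegral_support _ `]c, (Num.min t d)[).
- apply: eq_cintegral => s; rewrite inE/= in_itv/= lt_min => /and3P[cs _ sd].
  by rewrite patchE mem_setE in_itv/= cs sd.
- move=> s; rewrite /= !in_itv/= lt_min => /and3P[cs st _].
  by rewrite st (le_lt_trans c0).
- move=> s; rewrite /= !in_itv/= lt_min => /andP[_ ->] /= H.
  by rewrite patchE mem_setE in_itv/=; case: ifP.
Qed.

Lemma cprim_ext_left t : t <= c -> cprim 0 wext t = 0.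
Proof.
move=> tc; rewrite -[RHS](cintegral0 `]0, t[); apply: eq_cintegral => s.
move=> /set_mem; rewrite [X in X -> _]/= in_itv => /andP[_ st].
by rewrite patchE mem_setE in_itv/= ltNge (ltW (lt_le_trans st tc)).
Qed.

(** The zero extension has no jump: at an end point inside (0, 1) the Dirichlet
    condition makes u vanish, and at 0 and 1 there is nothing beyond. It is therefore
    the primitive of the extended derivative. *)
Lemma ext_wderiv : H1 0 1 ext /\ is_wderiv 0 1 ext wext.
Proof.
have [wL _] := wderivP Hu.
have up := H1_prim cd Hu (wderivP Hu).
apply: prim_H1; [exact: ltr01|exact: Lp2_patch|move=> t /andP[t0 t1]].
rewrite ext_at0; have [tc|ct] := ltP t c.
  rewrite cprim_ext_left ?(ltW tc)// addr0 ext_out ?uc//; last by rewrite negb_and -!ltNge tc.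
  by rewrite gt_eqF// (le_lt_trans t0).
rewrite cprim_ext//; have [td|dt] := leP t d.
  by rewrite ext_in ?ct// up ?ct.
rewrite ext_out; last by rewrite negb_and -!ltNge dt orbT.
rewrite -up ?lexx ?andbT ?(ltW cd)//.
by rewrite ud// lt_eqF// (lt_le_trans dt).
Qed.

Let Hext : H1 0 1 ext. Proof. by have [] := ext_wderiv. Qed.

Lemma ext_flux_ae : {ae mu, forall t, 0 < t < 1 -> flux P 0 1 ext t = aC P t * wext t}.
Proof.
have [_ W] := ext_wderiv.
by apply: ae_imp (is_wderiv_unique (wderivP Hext) W) => t H /H; rewrite /flux => ->.
Qed.

Lemma ext_flux_in : {ae mu, forall t, c < t < d -> flux P 0 1 ext t = flux P c d u t}.
Proof.
apply: ae_imp ext_flux_ae => t H /andP[ct td].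
rewrite H; last by rewrite (le_lt_trans c0 ct) (lt_le_trans td).
by rewrite patchE mem_setE in_itv/= ct td.
Qed.

Lemma ext_flux_left : {ae mu, forall t, 0 < t < c -> flux P 0 1 ext t = 0}.
Proof.
apply: ae_imp ext_flux_ae => t H /andP[t0 tc].
rewrite H; last by rewrite t0 (lt_le_trans tc)// (le_trans (ltW cd)).
by rewrite patchE mem_setE in_itv/= ltNge (ltW tc) mulr0.
Qed.

Lemma ext_flux_right : {ae mu, forall t, d < t < 1 -> flux P 0 1 ext t = 0}.
Proof.
apply: ae_imp ext_flux_ae => t H /andP[dt t1].
rewrite H; last by rewrite t1 (le_lt_trans _ dt)// (le_trans c0 (ltW cd)).
by rewrite patchE mem_setE in_itv/= [t < d]ltNge (ltW dt) andbF mulr0.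
Qed.

(** The test function does not vanish at c and d, so the right-hand side is not an
    instance of the equation on (c, d); the Green identity of weak_flux is what
    evaluates it. *)
Lemma ext_Lop phi : test_function 0 1 phi ->
  Lop P 0 1 ext phi = - regular_distr c d (flux P c d u) (derive1 phi) + regular_distr c d
      (reaction P u) phi.
Proof.
move=> tphi; rewrite Lop_fluxE.
have cphi := test_continuous tphi; have cphi' := test_continuous (test_derive1 tphi).
have Fi := flux_cintegrable a_Loo (lexx 0) (lexx 1) Hext.
have Fu := flux_cintegrable a_Loo c0 d1 Hu.
have S : `]c, d[ `<=` `]0, 1[ by exact: subset_itvW.
have Fp : cintegrable `]0, 1[ (patch (cst 0) `]c, d[ (flux P c d u)).
  split.
  - have -> : (fun t => complex.Re (patch (cst 0) `]c, d[ (flux P c d u) t)) =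
      (fun t => complex.Re (flux P c d u t)) \_ `]c, d[.
      by apply/funext => t; rewrite !patchE; case: ifP.
    by apply: integrableS (integrable_restrictT Fu.1).
  - have -> : (fun t => complex.Im (patch (cst 0) `]c, d[ (flux P c d u) t)) =
      (fun t => complex.Im (flux P c d u t)) \_ `]c, d[.
      by apply/funext => t; rewrite !patchE; case: ifP.
    by apply: integrableS (integrable_restrictT Fu.2).
have FE : {ae mu, forall t, 0 < t < 1 -> flux P 0 1 ext t =
    patch (cst 0) `]c, d[ (flux P c d u) t}.
  apply: ae_imp ext_flux_ae => t H /H ->.
  by rewrite !patchE; case: ifP => _; rewrite ?mulr0.
rewrite (regular_distr_ae cphi' Fi Fp FE); congr (- _ + _).
- rewrite /regular_distr (cintegral_support S); last first.
    by move=> t _ tcd; rewrite patchE memNset ?mul0r.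
  by apply: eq_cintegral => t tcd; rewrite patchE tcd.
- rewrite /regular_distr (cintegral_support S); last first.
    move=> t; rewrite /= !in_itv/= => t01 /negP tcd.
    by rewrite /reaction ext_out_oo// mulr0 mul0r.
  apply: eq_cintegral => t; rewrite inE/= in_itv/= => /andP[ct td].
  by rewrite /reaction ext_in// !ltW.
Qed.

Context (L : R[i] * R[i]) (s : R[i]) (y : R) (g : R -> R[i]).
Context (L1 : flux P c d u @ ess_at_right c --> L.1) (L2 : flux P c d u @ ess_at_left d --> L.2).

Lemma ext_lim_right : flux P 0 1 ext @ ess_at_right c --> L.1.
Proof. exact: (ess_right_eq cd ext_flux_in L1). Qed.

Lemma ext_lim_left : flux P 0 1 ext @ ess_at_left d --> L.2.
Proof. exact: (ess_left_eq cd ext_flux_in L2). Qed.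

Lemma ext_left_bc (gl : R[i]) : left_bc P c d gl u ->
    left_bc P 0 1 (if c == 0 then gl else 0) ext.
Proof.
have [cz|cn0] := eqVneq c 0; last first.
  move=> _; have cp : 0 < c by rewrite lt_neqAle eq_sym cn0 c0.
  apply: (zero_left_bc cp _ ext_flux_left).
  by rewrite ext_at0 uc.
rewrite /left_bc eqxx; case: eqVneq => [_|]; last by rewrite cz eqxx.
move=> -[_ <-].
have E1 := ext_lim_right; have E2 := L1.
rewrite [X in ess_at_right X]cz in E1; rewrite [X in ess_at_right X]cz in E2.
have E0 : ext 0 = u 0 by rewrite ext_at0 cz.
split; first by move=> _; apply/cvg_ex; exists L.1; exact: E1.
rewrite /B0 E0; exact: (robin_eq _ _ _ (etrans (lim_ess_at_right E1) (esym (lim_ess_at_right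
    E2)))).
Qed.

Lemma ext_at1 : ext 1 = u d.
Proof.
have [dz|dn1] := eqVneq d 1.
  by rewrite ext_in -?dz// lexx ltW.
by rewrite ud// ext_out// negb_and -!ltNge [d < 1]lt_neqAle dn1 d1 orbT.
Qed.

Lemma ext_right_bc (gr : R[i]) : right_bc P c d gr u ->
    right_bc P 0 1 (if d == 1 then gr else 0) ext.
Proof.
have [dz|dn1] := eqVneq d 1; last first.
  move=> _; have cp : d < 1 by rewrite lt_neqAle dn1 d1.
  apply: (zero_right_bc cp _ ext_flux_right).
  by rewrite ext_at1 ud.
rewrite /right_bc eqxx; case: eqVneq => [_|]; last by rewrite dz eqxx.
move=> -[_ <-].
have E1 := ext_lim_left; have E2 := L2.
rewrite [X in ess_at_left X]dz in E1; rewrite [X in ess_at_left X]dz in E2.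
have E0 : ext 1 = u 1 by rewrite ext_at1 dz.
split; first by move=> _; apply/cvg_ex; exists L.2; exact: E1.
rewrite /B1 E0; exact: (robin_eq _ _ _ (etrans (lim_ess_at_left E1) (esym (lim_ess_at_left E2)))).
Qed.

End Extension.

(** * Square linear systems *)

Section LinearSystem.

(** The range condition records which Dirac masses survive inside the open interval. *)
Lemma sum_kron (F : pzRingType) m n j (z : nat -> F) :
  \sum_(m <= k < n) (k == j)%:R * z k = if (m <= j < n)%N then z j else 0.
Proof.
rewrite -(@big_nat1_eq _ 0 +%R z j m n) [RHS]big_mkcond; apply: eq_bigr => k _.
by case: eqP => _; rewrite ?mul1r ?mul0r.
Qed.

(** A square matrix with trivial left kernel is invertible. Indices start at 1 to match
    the interior nodes. *)
Lemma square_system (F : fieldType) n (A : nat -> nat -> F) (b : nat -> F) :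
  (forall m : nat -> F, (forall k, (1 <= k < n)%N -> \sum_(1 <= j < n) m j * A j k = 0) ->
     forall j, (1 <= j < n)%N -> m j = 0) ->
  exists m : nat -> F, forall k, (1 <= k < n)%N -> \sum_(1 <= j < n) m j * A j k = b k.
Proof.
case: n => [|n] Ainj; first by exists (fun=> 0) => k; rewrite ltn0 andbF.
pose M : 'M[F]_n := \matrix_(j, k) A j.+1 k.+1.
pose coord (v : 'rV[F]_n) (j : nat) : F := if insub j.-1 is Some i then v 0 i else 0.
have sumE (v : 'rV[F]_n) k (kn : (k < n)%N) : \sum_(1 <= j < n.+1) coord v j * A j k.+1 =
    (v *m M) 0 (Ordinal kn).
  rewrite mxE big_add1 /= big_mkord; apply: eq_bigr => i _.
  by rewrite mxE /coord /= valK.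
have Mfree : row_free M.
  apply: inj_row_free => v vM; apply/rowP => i; rewrite [RHS]mxE.
  have := Ainj (coord v) _ i.+1; rewrite {2}/coord /= valK; apply; last by rewrite ltnS ltn_ord.
  by case=> // k /= kn; rewrite (sumE _ _ kn) vM mxE.
exists (coord ((\row_k b k.+1) *m invmx M)); case=> // k kn.
rewrite (sumE _ _ kn) mulmxKV ?mxE//.
by rewrite -row_free_unit.
Qed.

End LinearSystem.

(** * Local solutions as solutions on the unit interval *)

Section Packages.
Local Open Scope complex_scope.
Context {R : realType} (P : helmholtz R).
Context (a_Loo : Lp +oo%E 0 1 (aC P)) (k_Loo : Lp +oo%E 0 1 (coef_kappa P)).
Implicit Types (phi psi : R -> R) (u v w g h : R -> R[i]).
Local Notation mu := (@lebesgue_measure R).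

(** The Green identity seen from (0, 1): extending by zero creates at each end of [c,
    d] a Dirac mass weighted by the flux there. At 0 and 1 test functions vanish, so
    the same formula covers patches touching the boundary, where instead the boundary
    condition is inherited. *)
Lemma local_ext (c d y : R) (s gl gr : R[i]) (g u : R -> R[i]) (T : @Defs.distribution R) :
  0 <= c -> d <= 1 -> c < y < d -> cintegrable `]c, d[ g ->
  (forall phi, test_function c d phi -> T phi = s * (phi y)%:C + regular_distr c d g phi) ->
  weak_solution P c d T gl gr u ->
  let ext := patch (cst 0) `[c, d] u in
  exists L : R[i] * R[i],
  [/\ weak_solution P 0 1 (fun phi => s * (phi y)%:C + regular_distr c d g phi
        + L.1 * (phi c)%:C - L.2 * (phi d)%:C)
        (if c == 0 then gl else 0) (if d == 1 then gr else 0) ext,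
      flux P 0 1 ext @ ess_at_right c --> L.1 & flux P 0 1 ext @ ess_at_left d --> L.2].
Proof.
move=> c0 d1 cyd gi TE [Hu Lu lu ru] ext; have /andP[cy yd] := cyd; have cd := lt_trans cy yd.
have uc : c != 0 -> u c = 0 by move: lu; rewrite /left_bc; case: eqVneq.
have ud : d != 1 -> u d = 0 by move: ru; rewrite /right_bc; case: eqVneq.
have [phi tphi|L [L1 L2 LG]] := weak_flux a_Loo k_Loo c0 d1 cyd Hu gi (s := s).
  by rewrite Lu// TE.
exists L; split.
- split.
  + by have [] := ext_wderiv c0 cd d1 Hu uc ud.
  + by move=> phi tphi; rewrite (ext_Lop a_Loo c0 cd d1 Hu uc ud)// -LG//;
      exact: test_smooth tphi.
  + exact: (ext_left_bc c0 cd d1 Hu uc ud L1).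
  + exact: (ext_right_bc c0 cd d1 Hu uc ud L2).
- exact: (ext_lim_right c0 cd d1 Hu uc ud L1).
- exact: (ext_lim_left c0 cd d1 Hu uc ud L2).
Qed.

Lemma weak_sum m n (k gl gr : nat -> R[i]) (T : nat -> @Defs.distribution R) (u : nat -> R ->
    R[i]) :
  (forall j, (m <= j < n)%N -> weak_solution P 0 1 (T j) (gl j) (gr j) (u j)) ->
  weak_solution P 0 1 (fun phi => \sum_(m <= j < n) k j * T j phi)
    (\sum_(m <= j < n) k j * gl j) (\sum_(m <= j < n) k j * gr j)
    (fun t => \sum_(m <= j < n) k j * u j t).
Proof.
elim: n => [|n IH] H.
  under eq_fun do rewrite big_geq//;
      under [X in weak_solution _ _ _ _ _ _ X]eq_fun do rewrite big_geq//.
  rewrite !big_geq//; exact: weak_zero.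
have [mn|nm] := leqP m n; last first.
  under eq_fun do rewrite big_geq//;
      under [X in weak_solution _ _ _ _ _ _ X]eq_fun do rewrite big_geq//.
  rewrite !big_geq//; exact: weak_zero.
under eq_fun do rewrite big_nat_recr//=.
under [X in weak_solution _ _ _ _ _ _ X]eq_fun do rewrite big_nat_recr//=.
rewrite !big_nat_recr//=; apply: weak_linear => //.
  by apply: IH => j /andP[mj jn]; apply: H; rewrite mj ltnS ltnW.
by apply: H; rewrite mn /=.
Qed.

End Packages.

(** * Hat functions *)

Section Hats.
Context {R : realType} (N : nat) (x : nat -> R).
Context (N_ge2 : (2 <= N)%N) (x_first : x 0%N = 0) (x_last : x N = 1).
Context (x_incr : forall j, (j < N)%N -> x j < x j.+1).
Local Notation mu := (@lebesgue_measure R).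
Implicit Types t : R.

Lemma nodes_le i j : (i <= j)%N -> (j <= N)%N -> x i <= x j.
Proof.
elim: j => [|j IH]; first by rewrite leqn0 => /eqP ->.
rewrite leq_eqVlt => /predU1P[-> //|ij jN].
by apply: (le_trans (IH ij (ltnW jN))); rewrite ltW// x_incr.
Qed.

Lemma nodes_lt i j : (i < j)%N -> (j <= N)%N -> x i < x j.
Proof. by move=> ij jN; apply: lt_le_trans (nodes_le ij jN); apply: x_incr;
    exact: leq_trans jN. Qed.

Lemma xprev_ge0 j : (j <= N)%N -> 0 <= xprev x j.
Proof. by move=> jN; rewrite -x_first nodes_le// (leq_trans (leq_pred j)). Qed.

Lemma xnext_le1 j : xnext N x j <= 1.
Proof. by rewrite -x_last nodes_le// geq_minr. Qed.

Lemma xprev_lt_xnext j : (j <= N)%N -> xprev x j < xnext N x j.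
Proof.
move=> jN; apply: nodes_lt; last exact: geq_minr.
rewrite leq_min (leq_ltn_trans (leq_pred j))//=; case: j jN => [|j] //= _.
exact: (leq_trans _ N_ge2).
Qed.

Lemma xprev_le j : (j <= N)%N -> xprev x j <= x j.
Proof. by move=> jN; apply: nodes_le => //; exact: leq_pred. Qed.

Lemma xnext_ge j : (j <= N)%N -> x j <= xnext N x j.
Proof. by move=> jN; apply: nodes_le; [rewrite leq_min leqnSn jN|exact: geq_minr]. Qed.

Lemma hat_measurable j : measurable_fun setT (hat N x j).
Proof.
rewrite /hat; apply: measurable_fun_ifT => //; first exact: measurable_fun_eqr.
apply: measurable_fun_ifT => //.
- by apply: measurable_and; exact: measurable_fun_ltr.
- by apply: measurable_funM => //; exact: measurable_funB.
apply: measurable_fun_ifT => //.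
- by apply: measurable_and; exact: measurable_fun_ltr.
- by apply: measurable_funM => //; exact: measurable_funB.
Qed.

Lemma hat_itv j t : 0 <= hat N x j t <= 1.
Proof.
rewrite /hat; case: ifP => _; first by rewrite ler01 lexx.
case: ifP => [/andP[h1 h2]|_].
  have h := lt_trans h1 h2.
  by rewrite divr_ge0 ?subr_ge0 ?(ltW h1) ?(ltW h)//= ler_pdivrMr ?subr_gt0// mul1r lerB// ltW.
case: ifP => [/andP[h1 h2]|_]; last by rewrite lexx ler01.
have h := lt_trans h1 h2.
by rewrite divr_ge0 ?subr_ge0 ?(ltW h2) ?(ltW h)//= ler_pdivrMr ?subr_gt0// mul1r lerB// ltW.
Qed.

(** At the nodes 0 and 1 the hat function equals 1 at an end point of its patch, whence
    the restriction to the open unit interval. *)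
Lemma hat_out j t : (j <= N)%N -> 0 < t < 1 -> ~~ (xprev x j < t < xnext N x j) ->
    hat N x j t = 0.
Proof.
move=> jN /andP[t0 t1] tout; rewrite /hat; case: eqVneq => [tj|_].
  case/negP: tout; rewrite tj; apply/andP; split.
    by apply: nodes_lt => //; case: j jN tj => // _ tj; move: t0; rewrite tj x_first ltxx.
  apply: nodes_lt; last exact: geq_minr.
  rewrite leq_min leqnn /= ltn_neqAle jN andbT; apply/eqP => jN'.
  by move: t1; rewrite tj jN' x_last ltxx.
case: ifP => [/andP[h1 h2]|_].
  by case/negP: tout; rewrite h1 (lt_le_trans h2)// xnext_ge.
case: ifP => [/andP[h1 h2]|//].
by case/negP: tout; rewrite h2 (le_lt_trans _ h1)// xprev_le.
Qed.

Lemma in_cell t : 0 < t < 1 -> exists2 k, (k < N)%N & x k <= t < x k.+1.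
Proof.
move=> /andP[t0 t1]; have ex : exists k, t < x k by exists N; rewrite x_last.
case: (ex_minnP ex) => -[|k]; first by rewrite x_first ltNge (ltW t0).
move=> tk kmin; exists k; last first.
  by rewrite tk andbT leNgt; apply/negP => /kmin; rewrite ltnn.
by apply: kmin; rewrite x_last.
Qed.

(** In the cell [x_k, x_{k+1}) only the hats at x_k and x_{k+1} are non-zero, and they
    add up to 1. *)
Lemma hat_sum t : 0 < t < 1 -> \sum_(0 <= j < N.+1) hat N x j t = 1.
Proof.
move=> t01; have [k kN /andP[kt tk]] := in_cell t01.
rewrite (@big_cat_nat _ _ _ k)//=; last by rewrite ltnW// ltnW.
rewrite big_nat big1 ?add0r; last first.
  move=> j /andP[_ jk]; rewrite /hat.
  have jt : x j < t by apply: lt_le_trans kt; apply: nodes_lt => //; exact: ltnW.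
  have nt : xnext N x j <= t.
    apply: le_trans kt; rewrite /xnext (minn_idPl _); last exact: (leq_trans jk (ltnW kN)).
    by apply: nodes_le => //; exact: ltnW.
  rewrite gt_eqF// [t < x j]ltNge (ltW jt) andbF [t < xnext _ _ _]ltNge nt andbF//.
rewrite big_ltn; last by rewrite ltnW.
rewrite big_ltn//.
rewrite big_nat big1 ?addr0; last first.
  move=> j /andP[kj jN]; rewrite /hat.
  have tp : t < xprev x j.
    apply: (lt_le_trans tk); apply: nodes_le; first by case: j kj {jN}.
    by apply: (leq_trans (leq_pred j)).
  have tj : t < x j by apply: (lt_le_trans tp); exact: xprev_le.
  by rewrite lt_eqF// [xprev _ _ < _]ltNge (ltW tp) /= [x j < t]ltNge (ltW tj).
have D : x k.+1 - x k != 0 by rewrite subr_eq0 gt_eqF// x_incr.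
have -> : hat N x k.+1 t = (t - x k) / (x k.+1 - x k).
  rewrite /hat lt_eqF// /xprev /= tk andbT.
  have [->|tk'] := eqVneq t (x k).
    by rewrite ltxx [x k.+1 < x k]ltNge (ltW (x_incr kN)) /= subrr mul0r.
  by rewrite lt_neqAle eq_sym tk' kt.
have -> : hat N x k t = (x k.+1 - t) / (x k.+1 - x k).
  rewrite /hat; have [->|tk'] := eqVneq t (x k); first by rewrite divff.
  rewrite [t < x k]ltNge kt andbF /xnext (minn_idPl kN) tk andbT.
  by rewrite lt_neqAle eq_sym tk' kt.
by rewrite -mulrDl addrA subrK divff.
Qed.

End Hats.

(** * The extended local problems *)

Section Main.
Local Open Scope complex_scope.
Context {R : realType} (P : helmholtz R).
Context (a_Loo : Lp +oo%E 0 1 (aC P)) (k_Loo : Lp +oo%E 0 1 (coef_kappa P)).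
Context (f : R -> R[i]) (g0 g1 : R[i]) (f_L2 : Lp 2%:E 0 1 f).
Context (N : nat) (x : nat -> R).
Context (N_ge2 : (2 <= N)%N) (x_first : x 0%N = 0) (x_last : x N = 1).
Context (x_incr : forall j, (j < N)%N -> x j < x j.+1).
Local Notation mu := (@lebesgue_measure R).
Implicit Types (phi : R -> R).

Lemma weak_congr c d (T T' : @Defs.distribution R) gl gr (w : R -> R[i]) :
  distr_eq c d T T' -> weak_solution P c d T gl gr w -> weak_solution P c d T' gl gr w.
Proof. by move=> TT' [Hw Lw lw rw]; split=> // phi tphi; rewrite Lw// TT'. Qed.

Let fhat j (t : R) : R[i] := f t * (hat N x j t)%:C.

Lemma fhat_cintegrable j : cintegrable `]0, 1[ (fhat j).
Proof.
have [fr fi] := Lp2_cintegrable f_L2.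
have H (h : R -> R) : mu.-integrable `]0, 1[ (EFin \o h) ->
    mu.-integrable `]0, 1[ (EFin \o (fun t => h t * hat N x j t)).
  move=> hi; apply: (@integrable_ae_bounded _ _ _ _ 1) => //.
    by apply: measurable_funTS; exact: hat_measurable.
  by apply: ae_all => t _; have /andP[h0 h1] := hat_itv N x j t; rewrite ger0_norm.
split.
- have -> : (fun t => complex.Re (fhat j t)) = (fun t => complex.Re (f t) * hat N x j t).
    by apply/funext => t; rewrite cReMC.
  exact: H.
- have -> : (fun t => complex.Im (fhat j t)) = (fun t => complex.Im (f t) * hat N x j t).
    by apply/funext => t; rewrite cImMC.
  exact: H.
Qed.

Lemma regular_fhat j phi : (j <= N)%N ->
  regular_distr (xprev x j) (xnext N x j) (fhat j) phi = regular_distr 0 1 (fhat j) phi.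
Proof.
move=> jN; rewrite /regular_distr; apply/esym/cintegral_support.
  apply: subset_itvW; first exact: (xprev_ge0 x_first x_incr jN).
  exact: (xnext_le1 x_last x_incr).
move=> t; rewrite /= !in_itv/= => t01 /negP tout.
by rewrite /fhat (hat_out x_first x_last x_incr jN t01 tout) rmorph0 mulr0 mul0r.
Qed.

(** The midpoint of the patch carries a Dirac mass of weight 0, so that local_ext
    applies. *)
Lemma regular_ext j (u : R -> R[i]) : (j <= N)%N -> regular_local P N x f g0 g1 j u ->
  exists L : R[i] * R[i],
  [/\ weak_solution P 0 1 (fun phi => regular_distr 0 1 (fhat j) phi
        + L.1 * (phi (xprev x j))%:C - L.2 * (phi (xnext N x j))%:C)
        (left_data g0 j) (right_data N g1 j) (zero_ext N x j u),
      flux P 0 1 (zero_ext N x j u) @ ess_at_right (xprev x j) --> L.1 &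
      flux P 0 1 (zero_ext N x j u) @ ess_at_left (xnext N x j) --> L.2].
Proof.
move=> jN weak_u; have c0 := xprev_ge0 x_first x_incr jN; have d1 := xnext_le1 x_last x_incr j.
have cd := xprev_lt_xnext N_ge2 x_incr jN.
pose y := (xprev x j + xnext N x j) / 2.
have cyd : xprev x j < y < xnext N x j by rewrite /y; apply/andP; split; lra.
have fi := cintegrable_sub c0 d1 (fhat_cintegrable j).
have [|L [LW L1 L2]] := local_ext a_Loo k_Loo c0 d1 cyd fi (s := 0) _ weak_u.
  by move=> phi _; rewrite mul0r add0r.
exists L; split; [|exact: L1|exact: L2].
have -> : left_data g0 j = if xprev x j == 0 then left_data g0 j else 0.
  by case: j {jN weak_u c0 d1 cd y cyd fi L LW L1 L2} => [|j];
      rewrite /left_data /xprev /= ?x_first ?eqxx ?if_same.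
have -> : right_data N g1 j = if xnext N x j == 1 then right_data N g1 j else 0.
  rewrite /right_data; case: (eqVneq j N) => [->|_]; last by rewrite if_same.
  by rewrite /xnext (minn_idPr _) ?x_last ?eqxx.
apply: weak_congr LW => phi tphi.
by rewrite mul0r add0r regular_fhat.
Qed.

Lemma dirac_ext j (v : R -> R[i]) : (1 <= j < N)%N -> dirac_local P N x j v ->
  exists L : R[i] * R[i],
  weak_solution P 0 1 (fun phi => (phi (x j))%:C
        + L.1 * (phi (x j.-1))%:C - L.2 * (phi (x j.+1))%:C)
        0 0 (zero_ext N x j v).
Proof.
move=> /andP[j1 jN] vW; have jN' := ltnW jN.
have c0 := xprev_ge0 x_first x_incr jN'; have d1 := xnext_le1 x_last x_incr j.
have dE : xnext N x j = x j.+1 by rewrite /xnext (minn_idPl jN).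
have cyd : xprev x j < x j < xnext N x j.
  by rewrite dE x_incr// andbT; apply: (nodes_lt x_incr) => //; case: j j1 {jN jN' vW c0 d1 dE}.
have R0 phi : regular_distr (xprev x j) (xnext N x j) (cst 0) phi = 0.
  rewrite /regular_distr; under eq_cintegral do rewrite /= mul0r.
  exact: cintegral0.
have [|L [LW L1 L2]] := local_ext a_Loo k_Loo c0 d1 cyd (cintegrable0 _) (s := 1) _ vW.
  by move=> phi _; rewrite R0 mul1r addr0.
exists L; move: LW; rewrite !if_same; apply: weak_congr => phi tphi.
by rewrite R0 mul1r addr0 dE.
Qed.

Lemma sum_fhat phi : continuous phi ->
  \sum_(0 <= j < N.+1) regular_distr 0 1 (fhat j) phi = regular_distr 0 1 f phi.
Proof.
move=> cphi.
have E n : cintegrable `]0, 1[ (fun t => \sum_(0 <= j < n) fhat j t) /\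
  \sum_(0 <= j < n) regular_distr 0 1 (fhat j) phi =
      regular_distr 0 1 (fun t => \sum_(0 <= j < n) fhat j t) phi.
  elim: n => [|n [IH1 IH2]].
    have -> : (fun t => \sum_(0 <= j < 0) fhat j t) = cst 0 by apply/funext => t; rewrite big_geq.
    rewrite big_geq//; split; first exact: cintegrable0.
    rewrite /regular_distr; under eq_cintegral do rewrite /= mul0r.
    exact/esym/cintegral0.
  have -> : (fun t => \sum_(0 <= j < n.+1) fhat j t) =
      (fun t => \sum_(0 <= j < n) fhat j t + 1 * fhat n t).
    by apply/funext => t; rewrite big_nat_recr//= mul1r.
  split; first by apply: cintegrableD => //; apply: cintegrableZ => //; exact: fhat_cintegrable.
  by rewrite big_nat_recr//= IH2 (regular_distr_linear 1 cphi IH1 (fhat_cintegrable n)) mul1r.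
rewrite (E N.+1).2; apply: eq_cintegral => t; rewrite inE/= in_itv/= => t01.
congr (_ * _); rewrite /fhat -mulr_sumr -[RHS]mulr1; congr (_ * _).
by rewrite -(rmorph_sum (real_complex R)) (hat_sum x_first x_last x_incr t01).
Qed.

End Main.

(** * Injectivity of the linking system *)

Section Linking.
Local Open Scope complex_scope.
Context {R : realType} (P : helmholtz R).
Context (a_Loo : Lp +oo%E 0 1 (aC P)) (k_Loo : Lp +oo%E 0 1 (coef_kappa P)).
Context (N : nat) (x : nat -> R).
Context (N_ge2 : (2 <= N)%N) (x_first : x 0%N = 0) (x_last : x N = 1).
Context (x_incr : forall j, (j < N)%N -> x j < x j.+1).
Context (v : nat -> R -> R[i]).
Context (v_local : forall j, (1 <= j < N)%N -> dirac_local P N x j (v j)).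

Lemma dirac_weak j : (1 <= j < N)%N ->
  weak_solution P 0 1 (tilde_delta P N x v j) 0 0 (zero_ext N x j (v j)).
Proof.
move=> jN; have [L LW] := dirac_ext a_Loo k_Loo x_first x_last x_incr jN (v_local jN).
by apply: weak_congr (LW) => phi tphi; have [_ E _ _] := LW; rewrite /tilde_delta E.
Qed.

(** A bump around x_j is positive there, which L v_j = 0 would forbid. *)
Lemma dirac_not_zero j : (1 <= j < N)%N ->
  ~ (forall t, xprev x j <= t <= xnext N x j -> v j t = 0).
Proof.
move=> jN v0; have [Hv Lv _ _] := v_local jN; have /andP[j1 jN'] := jN.
have c0 := xprev_ge0 x_first x_incr (ltnW jN'); have d1 := xnext_le1 x_last x_incr j.
have cx : xprev x j < x j by apply: (nodes_lt x_incr); [case: (j) j1|exact: ltnW].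
have xd : x j < xnext N x j by rewrite /xnext (minn_idPl jN') x_incr.
have [_ _ L0] := zero_H1 a_Loo c0 (lt_trans cx xd) d1 v0.
pose p := (xprev x j + x j) / 2; pose q := (x j + xnext N x j) / 2.
have cp : xprev x j < p by rewrite /p; lra.
have px : p < x j by rewrite /p; lra.
have xq : x j < q by rewrite /q; lra.
have qd : q < xnext N x j by rewrite /q; lra.
have tb := smooth_bump_test 0 cp qd.
have := Lv _ tb; rewrite L0// /dirac_distr => /(congr1 (@complex.Re R)) /= /esym /eqP.
by rewrite gt_eqF// smooth_bump_gt0// px xq.
Qed.

Context (solvable01 : uniquely_solvable P 0 1).
Context (solvable_cell : forall j, (j < N)%N -> uniquely_solvable P (x j) (x j.+1)).

(** If v_j vanished to the left of x_j it would solve the homogeneous problem on the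
    next cell, with the Dirichlet condition at x_j, and so vanish on the whole patch. *)
Lemma dirac_left_zero j : (1 <= j < N)%N ->
  ~ (forall t, xprev x j <= t <= x j -> v j t = 0).
Proof.
move=> jN v0; apply: (dirac_not_zero jN) => t /andP[ct td].
have [tx|xt] := leP t (x j); first by apply: v0; rewrite ct tx.
have /andP[j1 jN'] := jN; have jN'' := ltnW jN'.
have [Hv Lv lv rv] := v_local jN.
have dE : xnext N x j = x j.+1 by rewrite /xnext (minn_idPl jN').
have c0 := xprev_ge0 x_first x_incr jN''; have d1 := xnext_le1 x_last x_incr j.
have cx : xprev x j <= x j by exact: (xprev_le x_incr).
have vx : v j (x j) = 0 by apply: v0; rewrite cx lexx.
have x0 : x j != 0 by rewrite gt_eqF// -x_first (nodes_lt x_incr).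
apply: (solvable_cell jN'); last by rewrite in_itv/= (ltW xt) -dE.
rewrite -dE; split.
- exact: (H1_sub cx (lexx _) Hv).
- move=> phi tphi; rewrite (Lop_sub a_Loo c0 cx (lexx _) d1 Hv tphi).
  rewrite (Lv _ (test_widen cx (lexx _) tphi)) /dirac_distr (test_out tphi) ?ltxx//.
- by rewrite /left_bc (negbTE x0).
- by apply: (right_bc_sub cx _ Hv rv); rewrite dE x_incr.
Qed.

(** The combination of the extended Dirac solutions solves the homogeneous problem on
    (0, 1), so it vanishes. By induction from the left, on the cell (x_{j-1}, x_j) it
    reduces to m_j v_j. *)
Lemma linking_inj (m : nat -> R[i]) :
  (forall phi, test_function 0 1 phi -> \sum_(1 <= j < N) m j * tilde_delta P N x v j phi = 0) ->
  forall j, (1 <= j < N)%N -> m j = 0.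
Proof.
move=> m0.
have W0 : {in `[0, 1], forall t, \sum_(1 <= j < N) m j * zero_ext N x j (v j) t = 0}.
  apply: solvable01.
  have := weak_sum a_Loo k_Loo m dirac_weak.
  rewrite [X in weak_solution _ _ _ _ X _ _]big1; last by move=> i _; rewrite mulr0.
  rewrite [X in weak_solution _ _ _ _ _ X _]big1; last by move=> i _; rewrite mulr0.
  by apply: weak_congr.
elim/ltn_ind=> j IH jN; have /andP[j1 jN'] := jN.
apply: contrapT => mj; apply: (dirac_left_zero jN) => t /andP[ct tx].
have tN : t \in `[0, 1].
  rewrite in_itv/= (le_trans _ ct) ?(xprev_ge0 x_first x_incr (ltnW jN'))//=.
  by rewrite (le_trans tx)// -x_last (nodes_le x_incr)// ltnW.
have := W0 t tN; rewrite (bigD1_seq j) ?mem_index_iota ?iota_uniq//= big1_seq ?addr0; last first.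
  move=> i /andP[ij]; rewrite mem_index_iota => /andP[i1 iN].
  have [ij'|ji] := ltnP i j; first by rewrite (IH i ij') ?mul0r ?i1.
  have {ij ji}ji : (j < i)%N by rewrite ltn_neqAle eq_sym ij.
  have tp : t <= xprev x i.
    apply: (le_trans tx); apply: (nodes_le x_incr); first by case: (i) ji.
    exact: (leq_trans (leq_pred i) (ltnW iN)).
  rewrite /zero_ext patchE mem_setE in_itv/=; case: ifP => [/andP[pt _]|_]; last by rewrite mulr0.
  have -> : t = xprev x i by apply/eqP; rewrite eq_le tp pt.
  have iN' : (1 <= i < N)%N by rewrite i1.
  have [_ _ lv _] := v_local iN'.
  move: lv; rewrite /left_bc gt_eqF; first by move=> ->; rewrite mulr0.
  rewrite -x_first; apply: (nodes_lt x_incr); last exact: (leq_trans (leq_pred i) (ltnW iN)).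
  by case: (i) ji => // i' ji; exact: leq_trans j1 ji.
rewrite /zero_ext patchE mem_setE in_itv/= ct (le_trans tx);
    last exact: (xnext_ge x_incr (ltnW jN')).
by move/eqP; rewrite mulf_eq0 => /orP[/eqP //|/eqP].
Qed.

End Linking.

(** * The decomposition theorem *)

Theorem theorem2p2 (R : realType) (P : helmholtz R)
  (f : R -> R[i]) (g0 g1 : R[i])
  (a_Linfty : Lp +oo%E 0 1 (aC P))
  (a_ess_inf : (0 < ess_inf_on 0 1 (coef_a P))%E)
  (kappa_Linfty : Lp +oo%E 0 1 (coef_kappa P))
  (f_L2 : Lp 2%:E 0 1 f)
  (lamL_neq0 : `|lam0L P| + `|lam1L P| != 0)
  (lamR_neq0 : `|lam0R P| + `|lam1R P| != 0)
  (a_lim0 : lam1L P != 0 -> cvg (aC P @ ess_at_right 0))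
  (a_lim1 : lam1R P != 0 -> cvg (aC P @ ess_at_left 1))
  (N : nat) (x : nat -> R)
  (N_ge2 : (2 <= N)%N)
  (x_first : x 0%N = 0) (x_last : x N = 1)
  (x_incr : forall j, (j < N)%N -> x j < x j.+1)
  (solvable01 : uniquely_solvable P 0 1)
  (solvable_patch : forall j, (1 <= j < N)%N ->
     uniquely_solvable P (x j.-1) (x j.+1))
  (solvable_cell : forall j, (j < N)%N -> uniquely_solvable P (x j) (x j.+1))
  (u v : nat -> R -> R[i])
  (u_local : forall j, (j <= N)%N -> regular_local P N x f g0 g1 j (u j))
  (v_local : forall j, (1 <= j < N)%N -> dirac_local P N x j (v j)) :
  exists mu : nat -> R[i],
    [/\ linking_system P N x u v mu,
        forall mu', linking_system P N x u v mu' ->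
          forall j, (1 <= j < N)%N -> mu' j = mu j &
        let U t := u_f N x u t + u_delta N x v mu t in
        weak_solution P 0 1 (regular_distr 0 1 f) g0 g1 U /\
        (forall w, weak_solution P 0 1 (regular_distr 0 1 f) g0 g1 w ->
           {in `[0, 1], w =1 U})].
Proof.
have a_Loo := a_Linfty; have k_Loo := kappa_Linfty.
pose z (phi : R -> R) k : R[i] := (phi (x k))%:C%C.
have z0 phi : test_function 0 1 phi -> z phi 0%N = 0.
  by move=> tphi; rewrite /z x_first (test_out tphi) ?ltxx.
have zN phi : test_function 0 1 phi -> z phi N = 0.
  by move=> tphi; rewrite /z x_last (test_out tphi) ?ltxx ?andbF.
have /choice[Lu HLu] : forall j, exists L : R[i] * R[i], (j <= N)%N -> [/\
    weak_solution P 0 1 (fun phi => regular_distr 0 1 (fun t => f t * (hat N x j t)%:C%C) phi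
        + L.1 * (phi (xprev x j))%:C%C - L.2 * (phi (xnext N x j))%:C%C)
        (left_data g0 j) (right_data N g1 j) (zero_ext N x j (u j)),
      flux P 0 1 (zero_ext N x j (u j)) @ ess_at_right (xprev x j) --> L.1 &
      flux P 0 1 (zero_ext N x j (u j)) @ ess_at_left (xnext N x j) --> L.2].
  move=> j; have [jN|_] := leqP j N; last by exists (0, 0).
  have [L HL] := regular_ext a_Loo k_Loo f_L2 N_ge2 x_first x_last x_incr jN (u_local j jN).
  by exists L => _; exact: HL.
have /choice[Lv HLv] : forall j, exists L : R[i] * R[i], (1 <= j < N)%N ->
    weak_solution P 0 1 (fun phi => (phi (x j))%:C%C
        + L.1 * (phi (x j.-1))%:C%C - L.2 * (phi (x j.+1))%:C%C) 0 0 (zero_ext N x j (v j)).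
  move=> j; have [jN|_] := boolP (1 <= j < N)%N; last by exists (0, 0).
  have [L HL] := dirac_ext a_Loo k_Loo x_first x_last x_incr jN (v_local j jN).
  by exists L => _; exact: HL.
(* Row j holds the weights of the Dirac masses in delta~_j. *)
pose A j k : R[i] := (k == j)%:R + (Lv j).1 * (k == j.-1)%:R - (Lv j).2 * (k == j.+1)%:R.
have deltaE j phi : (1 <= j < N)%N -> test_function 0 1 phi ->
    tilde_delta P N x v j phi = \sum_(1 <= k < N) A j k * z phi k.
  move=> jN tphi; have [_ E _ _] := HLv j jN; rewrite /tilde_delta E//.
  rewrite /A; under eq_bigr do rewrite mulrBl mulrDl -!mulrA.
  rewrite big_split/= sumrN big_split/= -!mulr_sumr !sum_kron jN.
  have /andP[j1 jN'] := jN; congr (_ + _ * _ - _ * _).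
    case: ifP => // /negbT; rewrite (leq_ltn_trans (leq_pred j) jN') andbT lt0n negbK => /eqP ->.
    exact: z0.
  rewrite /=; case: ltnP => // Nj; have -> : j.+1 = N by apply/eqP; rewrite eqn_leq jN' Nj.
  exact: zN.
have inj := linking_inj a_Loo k_Loo x_first x_last x_incr v_local solvable01 solvable_cell.
have sumE (m : nat -> R[i]) phi : test_function 0 1 phi ->
    \sum_(1 <= j < N) m j * tilde_delta P N x v j phi =
    \sum_(1 <= k < N) (\sum_(1 <= j < N) m j * A j k) * z phi k.
  move=> tphi; under [RHS]eq_bigr do rewrite mulr_suml.
  rewrite exchange_big/=; apply: eq_big_nat => j jN; rewrite deltaE// mulr_sumr.
  by apply: eq_bigr => k _; rewrite mulrA.
(* The interface residual that the Dirac corrections have to cancel. *)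
pose b k : R[i] := - (flux_right_end P (x k) (zero_ext N x k.-1 (u k.-1))
        + flux_left_end P (x k) (zero_ext N x k.+1 (u k.+1))).
have [m mA] : exists m : nat -> R[i], forall k, (1 <= k < N)%N ->
    \sum_(1 <= j < N) m j * A j k = b k.
  apply: square_system => m mA0; apply: inj => phi tphi; rewrite sumE//.
  by rewrite big_nat big1// => k kN; rewrite mA0// mul0r.
have rhsE phi : - (\sum_(1 <= j < N) (flux_right_end P (x j) (zero_ext N x j.-1 (u j.-1))
        + flux_left_end P (x j) (zero_ext N x j.+1 (u j.+1))) * dirac_distr (x j) phi) =
    \sum_(1 <= k < N) b k * z phi k.
  by rewrite -sumrN; apply: eq_bigr => k _; rewrite /b mulNr.
have mlink : linking_system P N x u v m.
  move=> phi tphi; rewrite rhsE sumE//; apply: eq_big_nat => k kN; by rewrite mA.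
exists m; split; [exact: mlink| |].
  move=> m' m'link j jN; apply/eqP; rewrite -subr_eq0; apply/eqP; move: j jN.
  apply: (inj (fun j => m' j - m j)) => phi tphi.
  under eq_bigr do rewrite mulrBl.
  by rewrite sumrB (m'link _ tphi) (mlink _ tphi) subrr.
have fluxE k : (1 <= k < N)%N -> b k = (Lu k.-1).2 - (Lu k.+1).1.
  move=> /andP[k1 kN]; rewrite /b /flux_right_end /flux_left_end.
  have kN' : (k.-1 <= N)%N by exact: (leq_trans (leq_pred k) (ltnW kN)).
  have [_ _ H2] := HLu _ kN'; have [_ H1 _] := HLu _ kN.
  have E : xnext N x k.-1 = x k by rewrite /xnext prednK// (minn_idPl (ltnW kN)).
  rewrite E in H2; rewrite /xprev /= in H1.
  by rewrite (lim_ess_at_left H2) (lim_ess_at_right H1) opprD opprK.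
(* Regrouping by node the masses that the patches leave at their left ends; the next
   fact does the same for the right ends. The masses at 0 and 1 are not seen by phi. *)
have shift_prev phi : test_function 0 1 phi ->
    \sum_(0 <= j < N.+1) (Lu j).1 * (phi (xprev x j))%:C%C =
        \sum_(1 <= k < N) (Lu k.+1).1 * z phi k.
  move=> tphi; have N0 : (0 < N)%N by exact: ltnW.
  rewrite big_ltn// (_ : xprev x 0 = x 0%N)// -/(z phi 0%N) z0// mulr0 add0r big_add1/=.
  by rewrite big_ltn// -/(z phi 0%N) z0// mulr0 add0r.
have shift_next phi : test_function 0 1 phi ->
    \sum_(0 <= j < N.+1) (Lu j).2 * (phi (xnext N x j))%:C%C =
        \sum_(1 <= k < N) (Lu k.-1).2 * z phi k.
  move=> tphi; rewrite (@big_cat_nat _ _ _ N.-1)//=; last by rewrite (leq_trans (leq_pred N)).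
  rewrite [X in _ + X]big_nat [X in _ + X]big1 ?addr0; last first.
    move=> j /andP[jN _]; rewrite /xnext (minn_idPr _) -/(z phi N) ?zN ?mulr0//.
    by case: (N) jN.
  rewrite [RHS]big_add1; apply: eq_big_nat => j /andP[_ jN].
  by rewrite /xnext (minn_idPl _)// (leq_trans jN)// leq_pred.
move=> U.
have UW : weak_solution P 0 1 (regular_distr 0 1 f) g0 g1 U.
  have weak_u j : (0 <= j < N.+1)%N ->
      weak_solution P 0 1 (fun phi => regular_distr 0 1 (fun t => f t * (hat N x j t)%:C%C) phi
        + (Lu j).1 * (phi (xprev x j))%:C%C - (Lu j).2 * (phi (xnext N x j))%:C%C)
        (left_data g0 j) (right_data N g1 j) (zero_ext N x j (u j)).
    by move=> jN; have [weak_u _ _] := HLu j jN; exact: weak_u.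
  have Wu := weak_sum a_Loo k_Loo (fun=> 1) weak_u.
  have Wv := weak_sum a_Loo k_Loo m (dirac_weak a_Loo k_Loo x_first x_last x_incr v_local).
  have := weak_linear a_Loo k_Loo 1 (lexx 0) ltr01 (lexx 1) Wu Wv.
  have gE (k : nat) (g : R[i]) : (k <= N)%N ->
      \sum_(0 <= j < N.+1) 1 * (if j == k then g else 0) = g.
    move=> kN; under eq_bigr do rewrite mul1r.
    by rewrite -big_mkcond big_nat1_eq ltnS kN.
  have -> : \sum_(0 <= j < N.+1) 1 * left_data g0 j + 1 * \sum_(1 <= j < N) m j * 0 = g0.
    by rewrite gE// [X in _ + 1 * X]big1 ?mulr0 ?addr0// => j _; rewrite mulr0.
  have -> : \sum_(0 <= j < N.+1) 1 * right_data N g1 j + 1 * \sum_(1 <= j < N) m j * 0 = g1.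
    by rewrite gE// [X in _ + 1 * X]big1 ?mulr0 ?addr0// => j _; rewrite mulr0.
  have -> : (fun t => \sum_(0 <= j < N.+1) 1 * zero_ext N x j (u j) t +
      1 * \sum_(1 <= j < N) m j * zero_ext N x j (v j) t) = U.
    apply/funext => t; rewrite mul1r; congr (_ + _).
    by apply: eq_bigr => j _; rewrite mul1r.
  apply: weak_congr => phi tphi; have cphi := test_continuous tphi.
  under eq_bigr do rewrite mul1r.
  rewrite mul1r big_split/= sumrN big_split/= (sum_fhat f_L2 x_first x_last x_incr cphi).
  rewrite shift_prev// shift_next// (mlink _ tphi) rhsE.
  rewrite -addrA -addrA [X in _ + X](_ : _ = 0) ?addr0//.
  rewrite -sumrN -!big_split/= big_nat big1// => k kN.
  by rewrite fluxE//; ring.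
split; first exact: UW.
move=> w ww t t01.
have := weak_linear a_Loo k_Loo (-1) (lexx 0) ltr01 (lexx 1) ww UW.
rewrite !mulN1r !subrr => WW.
have : weak_solution P 0 1 (fun=> 0) 0 0 (fun t => w t + -1 * U t).
  by apply: weak_congr WW => phi tphi; rewrite mulN1r subrr.
by move=> /solvable01/(_ t t01)/eqP; rewrite mulN1r subr_eq0 => /eqP.
Qed.
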